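(* Let $A:U_\infty\to\mathcal M^{n\times n}_{\rm sym}$ and $b:U_\infty\to\mathbb R^n$ be given functions. Assume there are constants $c_0>0$, $M_1>0$, $M_2\ge0$ such that for all $(x,t)\in U_\infty$ and all $\xi\in\mathbb R^n$, $$\xi^{\rm T}A(x,t)\xi\ge c_0|\xi|^2,\qquad {\rm Tr}(A(x,t))\le M_1,\qquad |b(x,t)|\le M_2.$$ Let $w\in C(\overline{U_\infty})\cap C^{2,1}_{x,t}(U_\infty)$. Given any point $x_0\notin\bar U$, set $r_0=r_*(x_0)$, $R=R_*(x_0)$, $$\beta_*=\frac{1}{2c_0}(M_1+M_2R),\qquad T_*=\frac{R^2}{4c_0\beta_*},\qquad \eta_*=1-(r_0/R)^{2\beta_*}.$$ (i) Suppose there is a function $F_1\in C([0,\infty),[0,\infty))$ such that $\widetilde Lw(x,t)\le F_1(t)$ for all $(x,t)\in U_\infty$. Then $$\limsup_{t\to\infty}\left[\max_{x\in\bar U}w^+(x,t)\right]\le\frac{2-\eta_*}{1-\eta_*}\left(\limsup_{t\to\infty}\left[\max_{x\in\Gamma}w^+(x,t)\right]+\limsup_{t\to\infty}\int_t^{t+T_*}F_1(\tau)\,{\rm d}\tau\right).$$ (ii) Suppose there is a function $F\in C([0,\infty),[0,\infty))$ such that $|\widetilde Lw(x,t)|\le F(t)$ for all $(x,t)\in U_\infty$. Then $$\limsup_{t\to\infty}\left[\max_{x\in\bar U}|w(x,t)|\right]\le\frac{2-\eta_*}{1-\eta_*}\left(\limsup_{t\to\infty}\left[\max_{x\in\Gamma}|w(x,t)|\right]+\limsup_{t\to\infty}\int_t^{t+T_*}F(\tau)\,{\rm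 d}\tau\right).$$
   Context: $n\ge1$ is fixed; $U$ is a non-empty, open, bounded subset of $\mathbb R^n$ with boundary $\Gamma$ and closure $\bar U$. $U_\infty=U\times(0,\infty)$, $\overline{U_\infty}=\bar U\times[0,\infty)$. $\mathcal M^{n\times n}_{\rm sym}$ is the set of real symmetric $n\times n$ matrices. $C^{2,1}_{x,t}(U\times I)$, for an interval $I$, is the class of continuous functions on $U\times I$ with continuous partial derivatives $\partial u/\partial t$, $\partial u/\partial x_i$, $\partial^2u/\partial x_i\partial x_j$. $\langle A,B\rangle={\rm Tr}(A^{\rm T}B)$; $D^2w$, $\nabla w$ are the Hessian and gradient in $x$. $w^+=\max\{0,w\}$. For $y\notin\bar U$: $r_*(y)=\min\{|x-y|:x\in\bar U\}$, $R_*(y)=\max\{|x-y|:x\in\bar U\}$. $\widetilde Lw=w_t-\langle A(x,t),D^2w\rangle+b(x,t)\cdot\nabla w$. Limits superior are taken in $[0,\infty]$. *)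

(* Defs.v *)
From HB Require Import structures.
From mathcomp Require Import all_boot all_order all_algebra.
From mathcomp Require Import all_classical all_reals all_analysis.

Set Implicit Arguments.
Unset Strict Implicit.
Unset Printing Implicit Defensive.

Import Order.TTheory GRing.Theory Num.Theory.
Import numFieldNormedType.Exports.

Local Open Scope classical_set_scope.
Local Open Scope ring_scope.

Section Defs.
Variables (R : realType) (n : nat).
Implicit Types (U S : set 'rV[R]_n) (x y u v : 'rV[R]_n) (p : 'rV[R]_n * R)
  (D : set ('rV[R]_n * R)) (w : 'rV[R]_n * R -> R).

Definition dotv u v : R := \sum_(i < n) u 0 i * v 0 i.

(* The norm `|u| of MathComp-Analysis on matrices is the max norm; this is the
   Euclidean norm.  Both induce the same topology. *)
Definition enorm u : R := Num.sqrt (dotv u u).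

(* Distances from y to the points of closure U.  For U nonempty and bounded,
   closure U is nonempty and compact, so the infimum and the supremum are
   attained: they are a minimum and a maximum. *)
Definition r_star U y : R := inf [set enorm (x - y) | x in closure U].
Definition R_star U y : R := sup [set enorm (x - y) | x in closure U].

Definition bdry S : set 'rV[R]_n := closure S `\` interior S.

Definition cyl U : set ('rV[R]_n * R) := U `*` [set t | 0 < t].
Definition ccyl U : set ('rV[R]_n * R) := closure U `*` [set t | 0 <= t].

Definition e_ (i : 'I_n) : 'rV[R]_n := delta_mx 0 i.

Definition slice_x w (t : R) : 'rV[R]_n -> R := fun x => w (x, t).
Definition slice_t w x : R -> R := fun t => w (x, t).

Definition dt w p : R := derive1 (slice_t w p.1) p.2.
Definition dx (i : 'I_n) w p : R := 'D_(e_ i) (slice_x w p.2) p.1.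

Definition grad w p : 'rV[R]_n := \row_i dx i w p.
Definition hess w p : 'M[R]_n := \matrix_(i, j) dx i (dx j w) p.

(* The existence clauses are separate from the continuity clauses because
   'D_v f x and derive1 f x are total and say nothing when the limit of the
   difference quotients does not exist.  D is meant to be open, so that
   two-sided difference quotients are the right ones. *)
Definition C21 D w : Prop :=
  [/\ {within D, continuous w},
      (forall p, D p -> derivable (slice_t w p.1) p.2 1) /\
        {within D, continuous (dt w)},
      (forall i p, D p -> derivable (slice_x w p.2) p.1 (e_ i)) /\
        (forall i, {within D, continuous (dx i w)}) &
      (forall i j p, D p -> derivable (slice_x (dx j w) p.2) p.1 (e_ i)) /\
        (forall i j, {within D, continuous (dx i (dx j w))})].

Definition mxinner (A B : 'M[R]_n) : R := \tr (A^T *m B).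

Definition Ltilde (A : 'rV[R]_n * R -> 'M[R]_n) (b : 'rV[R]_n * R -> 'rV[R]_n)
    w p : R :=
  dt w p - mxinner (A p) (hess w p) + dotv (b p) (grad w p).

(* For S nonempty and compact and f continuous on S this is the (finite)
   maximum of f on S. *)
Definition maxS S (f : 'rV[R]_n -> R) : \bar R :=
  ereal_sup [set (f x)%:E | x in S].

(* F restricts to an element of C([0,oo), [0,oo)). *)
Definition C_nneg (F : R -> R) : Prop :=
  {within [set t | 0 <= t], continuous F} /\ (forall t, 0 <= t -> 0 <= F t).

Definition limsup_oo (f : R -> \bar R) : \bar R :=
  limf_esup f (pinfty_nbhs R).

Definition window_int (F : R -> R) (T t : R) : \bar R :=
  (\int[@lebesgue_measure R]_(s in `[t, (t + T)%R]%classic) (F s)%:E)%E.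

End Defs.

(* Main.v *)
Require Import Defs.
From HB Require Import structures.
From mathcomp Require Import all_boot all_order all_algebra.
From mathcomp Require Import all_classical all_reals all_analysis.
From mathcomp Require Import ring lra.
Import Order.TTheory GRing.Theory Num.Theory.
Import numFieldNormedType.Exports.
Local Open Scope classical_set_scope.
Local Open Scope ring_scope.

Set Implicit Arguments.
Unset Strict Implicit.

(** With tau = t - s and d = |x - x0|, the function
    q = exp(kappa - beta ln tau - d^2 / (4 c0 tau)), a time-shifted multiple of a
    heat kernel, is a subsolution precisely because
    beta = (M1 + M2 R) / (2 c0).  For the right kappa it is at most 1 on the
    closure of U, at least (r0 / R)^(2 beta) = 1 - eta at time s + T, and it
    vanishes as t decreases to s.  If w <= K on the closure of U for times in
    [s, s + T) and w <= m on the boundary from s on, comparing w with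
    m + int_s^t F + K (1 - q) gives w <= m + int_s^(s+T) F + eta K at time s + T.
    Iterating over successive periods bounds the limit superior by
    (m + I) / (1 - eta), which is at most (2 - eta) / (1 - eta) (m + I). *)

(** * Calculus along lines *)

(** At a fixed distance [rho] from [x0] the barrier, as a function of [tau], peaks at
    [rho^2 / (4 c0 beta)], with height proportional to [rho^(-2 beta)]. The normalisation puts the
    peak at distance [r0] at height 1, and [T] is the peak time at distance [R]; the ratio of the
    two heights is [(r0 / R)^(2 beta)], whence [eta]. Because [x0] is outside the closure of [U],
    distances stay above [r0], so the barrier tends to 0 uniformly in space at its birth and never
    exceeds 1. Each target time [t] gets its own barrier, born at [t - T], so one bound on a full
    period controls every time of the next one, and the forcing enters only through windows of
    length exactly [T].

    The obstacle on the analytic side is that [C21] provides derivatives along coordinate axes only,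
    while [A] has no reason to be diagonal. With [A = V^T V], the trace term is a sum of second
    derivatives along the rows of [V]; this calls for derivatives in arbitrary directions, which
    come from the continuity of the partial derivatives. *)

(** Both sides have the same difference quotients; this lets one-variable calculus act on functions
    of [x]. *)
Lemma is_derive_line (R : realType) (V : normedModType R) (f : V -> R)
    (x v : V) (h0 d : R) :
  is_derive (h0 *: v + x) v f d <->
  is_derive h0 (1 : R) (fun h => f (h *: v + x)) d.
Proof.
set g := fun h : R => f (h *: v + x).
have E : (fun h : R => h^-1 *: (f (h *: v + (h0 *: v + x)) - f (h0 *: v + x)))
  = (fun h : R => h^-1 *: (g (h *: (1 : R) + h0) - g h0)).
  by apply/funext => h; rewrite /g [h *: 1]mulr1 scalerDl addrA.
have E1 : derivable f (h0 *: v + x) v = derivable g h0 1.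
  by rewrite /derivable E.
have E2 : 'D_v f (h0 *: v + x) = 'D_1 g h0 by rewrite /derive E.
split=> -[d1 d2]; constructor.
- by rewrite -E1.
- by rewrite -E2.
- by rewrite E1.
- by rewrite E2.
Qed.

Lemma is_derive_continuous (R : realType) (f : R -> R) (x d : R) :
  is_derive x (1 : R) f d -> {for x, continuous f}.
Proof.
by move=> fd; apply/differentiable_continuous/derivable1_diffP.
Qed.

Lemma is_derive_near_pos (R : realType) (f : R -> R) (a : R) :
  is_derive (0 : R) (1 : R) f a -> f 0 = 0 -> 0 < a ->
  exists2 d : R, 0 < d & forall h, 0 < h -> h < d -> 0 < f h.
Proof.
move=> [df fa] f0 a0.
have c : (fun h : R => h^-1 *: (f (h *: 1 + 0) - f 0)) @ 0^' --> a.
  by rewrite -fa; exact: df.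
have := cvgr_gt _ c _ a0.
move=> [d /= d0 H]; exists d => // h h0 hd.
have := H h; rewrite /ball /= sub0r normrN gtr0_norm // => /(_ hd (lt0r_neq0 h0)).
by rewrite f0 subr0 addr0 [h *: 1]mulr1 [_ *: _]/(_ * _) pmulr_rgt0 ?invr_gt0.
Qed.

(** The second derivative need exist only at 0: if [a] were positive, [g] would be positive just to
    the right of its zero, and the mean value theorem would make [f] exceed its maximum there. *)
Lemma second_derivative_test (R : realType) (f g : R -> R) (a e : R) :
  0 < e -> (forall h, `|h| < e -> is_derive h (1 : R) f (g h)) ->
  is_derive (0 : R) (1 : R) g a -> (forall h, `|h| < e -> f h <= f 0) ->
  g 0 = 0 /\ a <= 0.
Proof.
move=> e0 fg ga fmax.
have g0 : g 0 = 0.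
  have H : is_derive (0 : R) (1 : R) f 0.
    apply: (@derive1_at_max R f (- e) e 0); rewrite ?in_itv /= ?oppr_lt0 ?e0 //.
    - lra.
    - by move=> t; rewrite in_itv /= -ltr_norml => /fg[].
    - by move=> t; rewrite in_itv /= -ltr_norml => /fmax.
  by have [_ <-] := fg 0 ltac:(by rewrite normr0); case: H.
split=> //; rewrite leNgt; apply/negP => a0.
have [d d0 H] := is_derive_near_pos ga g0 a0.
pose h := Num.min d e / 2.
have [h0 hd he] : [/\ 0 < h, h < d & h < e].
  have := lt_min 0 d e; rewrite d0 e0 /= => m0.
  have m1 : Num.min d e <= d by rewrite ge_min lexx.
  have m2 : Num.min d e <= e by rewrite ge_min lexx orbT.
  by rewrite /h; split; lra.
have [| |c] := @MVT R f g 0 h h0.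
- move=> x; rewrite in_itv /= => /andP[x0 xh]; apply: fg.
  by rewrite gtr0_norm // (lt_trans xh).
- apply: continuous_in_subspaceT => x; rewrite inE /= in_itv /= => /andP[x0 xh].
  apply: is_derive_continuous; apply: fg.
  by rewrite ger0_norm // (le_lt_trans xh).
rewrite in_itv /= => /andP[c0 ch] E.
have gc := H c c0 (lt_trans ch hd).
have := fmax h ltac:(by rewrite gtr0_norm).
by rewrite -subr_le0 E subr0 leNgt mulr_gt0.
Qed.

(** Only earlier times are compared, since the maximum over a closed time interval may sit at the
    final time. *)
Lemma derive_left_max (R : realType) (f : R -> R) (x a e : R) :
  0 < e -> is_derive x (1 : R) f a ->
  (forall h, 0 < h -> h < e -> f (x - h) <= f x) -> 0 <= a.
Proof.
move=> e0 fa fmax; rewrite leNgt; apply/negP => a0.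
(* Reversing time turns the left-hand situation into the right-hand one of [is_derive_near_pos]. *)
have ga : is_derive (0 : R) (1 : R) (fun h : R => f (x - h) - f x) (- a).
  have fa' : is_derive ((cst x - id : R -> R) 0) (1 : R) f a.
    by rewrite [_ 0]subr0.
  have gd : is_derive (0 : R) (1 : R) (cst x - id : R -> R) (- 1).
    by apply: is_derive_eq; rewrite sub0r.
  have fg := is_derive1_comp fa' gd.
  apply: is_derive_eq (is_deriveB fg (is_derive_cst (f x) _ _)) _.
  by rewrite subr0 mulrN1.
have [||d d0 H] := is_derive_near_pos ga; rewrite ?subr0 ?subrr ?oppr_gt0 //.
pose h := Num.min d e / 2.
have [h0 hd he] : [/\ 0 < h, h < d & h < e].
  have := lt_min 0 d e; rewrite d0 e0 /= => m0.
  have m1 : Num.min d e <= d by rewrite ge_min lexx.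
  have m2 : Num.min d e <= e by rewrite ge_min lexx orbT.
  by rewrite /h; split; lra.
have := H h h0 hd; have := fmax h h0 he; lra.
Qed.

(** The mean value theorem on one coordinate leg. The slope [l] is free because it will be the
    partial derivative at the base point of the whole path, not at the start of the leg. *)
Lemma increment_linear_approx (R : realType) (f g : R -> R) (l e s : R) :
  (forall u, `|u| <= `|s| -> is_derive u (1 : R) f (g u)) ->
  (forall u, `|u| <= `|s| -> `|g u - l| <= e) ->
  `|f s - f 0 - s * l| <= e * `|s|.
Proof.
move=> fg gl.
have fc u : `|u| <= `|s| -> {for u, continuous f}.
  by move=> /fg; exact: is_derive_continuous.
suff [c cs ->] : exists2 c, `|c| <= `|s| & f s - f 0 = g c * s.
  by rewrite [s * l]mulrC -mulrBl normrM ler_wpM2r // gl.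
have [s0|s0] := leP 0 s.
- have inI x : x \in `[0, s]%R -> `|x| <= `|s|.
    by rewrite in_itv /= => /andP[x0 xs]; rewrite (ger0_norm x0) (ger0_norm s0).
  have [x xs| |c cs] := @MVT_segment R f g 0 s s0.
  + by apply/fg/inI; apply: subset_itv_oo_cc xs.
  + by apply: continuous_in_subspaceT => x; rewrite inE /= => /inI /fc.
  + by rewrite subr0 => E; exists c => //; exact: inI.
- have inI x : x \in `[s, 0]%R -> `|x| <= `|s|.
    rewrite in_itv /= => /andP[x0 xs]; rewrite (ler0_norm xs) (ltr0_norm s0).
    by rewrite lerN2.
  have [x xs| |c cs] := @MVT_segment R f g s 0 (ltW s0).
  + by apply/fg/inI; apply: subset_itv_oo_cc xs.
  + by apply: continuous_in_subspaceT => x; rewrite inE /= => /inI /fc.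
  + rewrite sub0r => E; exists c; first exact: inI.
    by rewrite -[LHS]opprB E mulrN opprK.
Qed.

Lemma norm_delta_mx_le1 (R : realType) (n : nat) (i : 'I_n) :
  `|delta_mx 0 i : 'rV[R]_n| <= 1.
Proof.
rewrite [`|_|]mx_normrE; apply/bigmax_leP; split => // -[j k] _ /=.
by rewrite mxE; case: (_ && _); rewrite ?normr1 ?normr0.
Qed.

Lemma norm_sum_delta_le (R : realType) (n : nat) (v : 'rV[R]_n) (s : seq 'I_n) :
  `|\sum_(j <- s) v 0 j *: delta_mx 0 j : 'rV[R]_n| <= \sum_(j <- s) `|v 0 j|.
Proof.
apply: le_trans (ler_norm_sum _ _ _) _; apply: ler_sum => j _.
by rewrite normrZ ler_piMr // norm_delta_mx_le1.
Qed.

(* The displacement [h v] is travelled one coordinate at a time, in the order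
   given by [s]. *)
Lemma coordinatewise_increment (R : realType) (n : nat) (g : 'rV[R]_n -> R)
    (d : 'I_n -> 'rV[R]_n -> R) (x v : 'rV[R]_n) (r e h : R) (s : seq 'I_n) :
  0 <= e ->
  (forall i y, `|y - x| < r -> is_derive y (delta_mx 0 i) g (d i y)) ->
  (forall i y, `|y - x| < r -> `|d i y - d i x| <= e) ->
  `|h| * (\sum_(j <- s) `|v 0 j|) < r ->
  `|g (h *: (\sum_(j <- s) v 0 j *: delta_mx 0 j) + x) - g x
    - h * \sum_(j <- s) v 0 j * d j x| <= e * (`|h| * \sum_(j <- s) `|v 0 j|).
Proof.
move=> e0 gd dx; elim: s => [|i s IH].
  by rewrite !big_nil scaler0 add0r subrr !mulr0 subrr normr0.
rewrite !big_cons; set w := \sum_(j <- s) _ *: _; set m := \sum_(j <- s) _.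
set l := \sum_(j <- s) _ => hr.
have mge0 : `|w| <= m by exact: norm_sum_delta_le.
have hs : `|h| * m < r.
  by apply: le_lt_trans hr; rewrite ler_wpM2l // lerDr.
set y := h *: w + x.
(* Every point of the current leg stays in the ball: basis vectors have max norm at most 1, so
   lengths add up to at most [|h|] times the sum of the [|v 0 j|]. *)
have near u : `|u| <= `|h * v 0 i| -> `|(u *: delta_mx 0 i + y) - x| < r.
  move=> ui; apply: le_lt_trans hr; rewrite /y addrA addrK mulrDr.
  apply: le_trans (ler_normD _ _) _; rewrite !normrZ; apply: lerD.
    rewrite -normrM; apply: le_trans ui.
    by rewrite ler_piMr // norm_delta_mx_le1.
  by rewrite ler_wpM2l.
have := @increment_linear_approx R (fun u => g (u *: delta_mx 0 i + y))
  (fun u => d i (u *: delta_mx 0 i + y)) (d i x) e (h * v 0 i).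
rewrite scale0r add0r => /(_ _ _) A.
have {}A := A (fun u ui => (is_derive_line _ _ _ _ _).1 (gd i _ (near u ui)))
  (fun u ui => dx i _ (near u ui)).
have -> : h *: (v 0 i *: delta_mx 0 i + w) + x = (h * v 0 i) *: delta_mx 0 i + y.
  by rewrite scalerDr scalerA addrA.
have -> : forall a : R, a - g x - h * (v 0 i * d i x + l)
    = (a - g y - h * v 0 i * d i x) + (g y - g x - h * l).
  by move=> a; ring.
apply: le_trans (ler_normD _ _) _.
rewrite mulrDr mulrDr -normrM; apply: lerD => //; exact: IH.
Qed.

(** Going to [h v] along the axes replaces each partial derivative by its value at [x] up to a small
    error, by continuity; the total error is a small multiple of [|h|]. *)
Lemma is_derive_partials (R : realType) (n : nat) (g : 'rV[R]_n -> R)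
    (d : 'I_n -> 'rV[R]_n -> R) (x v : 'rV[R]_n) :
  (\forall y \near x, forall i, is_derive y (delta_mx 0 i) g (d i y)) ->
  (forall i, {for x, continuous (d i)}) ->
  is_derive x v g (\sum_i v 0 i * d i x).
Proof.
move=> gd dc; set L := \sum_i _.
suff c : (fun h : R => h^-1 *: (g (h *: v + x) - g x)) @ 0^' --> L.
  by apply: DeriveDef; [apply/cvg_ex; exists L | apply/cvg_lim].
apply/cvgrPdist_le => /= e e0.
set m := \sum_i `|v 0 i|.
have m0 : 0 <= m by apply: sumr_ge0.
pose e1 := e / (m + 1); have e10 : 0 < e1 by rewrite divr_gt0 // ltr_wpDl.
have dn : \forall y \near x, forall i, `|d i y - d i x| <= e1.
  have := @filter_forall _ _ (fun i y => `|d i y - d i x| <= e1) (nbhs x) _.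
  apply=> i; have /cvgrPdist_le /(_ e1 e10) := dc i.
  by apply: filterS => y; rewrite distrC.
have [r /= r0 H] : exists2 r : R, 0 < r & forall y, `|y - x| < r ->
    (forall i, is_derive y (delta_mx 0 i) g (d i y)) /\
    (forall i, `|d i y - d i x| <= e1).
  have [r r0 H] := (nbhs_normP _ _).1 (filterI gd dn).
  by exists r => // y yx; apply: H; rewrite /ball_ /= distrC.
near=> h.
have h0 : h != 0 by near: h; exact: nbhs_dnbhs_neq.
have hr : `|h| * m < r.
  apply: (@le_lt_trans _ _ (`|h| * (m + 1))).
    by rewrite ler_wpM2l // lerDl.
  rewrite -ltr_pdivlMr ?ltr_wpDl //.
  by near: h; apply: dnbhs0_lt; rewrite divr_gt0 // ltr_wpDl.
have := @coordinatewise_increment R n g d x v r e1 h (index_enum 'I_n) (ltW e10)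
  (fun i y yx => (H y yx).1 i) (fun i y yx => (H y yx).2 i) hr.
rewrite -row_sum_delta -/L -/m => A.
have -> : L - h^-1 *: (g (h *: v + x) - g x)
    = - h^-1 * (g (h *: v + x) - g x - h * L).
  by rewrite mulNr mulrBr opprB mulKf.
rewrite normrM normrN normfV mulrC ler_pdivrMr ?normr_gt0 //.
apply: le_trans A _; rewrite mulrCA mulrC ler_wpM2r //.
by rewrite /e1 mulrAC ler_pdivrMr ?ltr_wpDl // ler_pM2l // lerDl.
Unshelve. all: by end_near. Qed.

(** * Positive definite matrices *)

(** Induction on the size through the Schur complement of the top left entry. *)
Lemma cholesky (R : realType) (n : nat) (A : 'M[R]_n) :
  A^T = A -> (forall v : 'rV[R]_n, v != 0 -> 0 < (v *m A *m v^T) 0 0) ->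
  exists V : 'M[R]_n, A = V^T *m V.
Proof.
elim: n A => [|n IH] A; first by exists 0; apply/matrixP => -[].
move: A; rewrite -[n.+1]/(1 + n)%N => A As Ap.
set a := A 0 0; set u := ursubmx A; set B := drsubmx A.
have EA : A = block_mx a%:M u u^T B.
  rewrite -[LHS]submxK; congr block_mx.
    by rewrite [LHS]mx11_scalar !mxE; congr (A _ _)%:M; apply/val_inj.
  by rewrite -[in LHS]As /u trmx_ursub.
have a0 : 0 < a.
  have := Ap (delta_mx 0 0); rewrite -rowE.
  have -> : delta_mx 0 0 != 0 :> 'rV[R]_(1 + n).
    by apply/eqP => /rowP/(_ 0)/eqP; rewrite !mxE eqxx oner_eq0.
  by rewrite trmx_delta -colE !mxE; apply.
have [||V EV] := IH (B - a^-1 *: (u^T *m u)).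
- rewrite linearB linearZ /= trmx_mul trmxK; congr (_ - _).
  by rewrite /B trmx_drsub As.
(* This first coordinate minimises the full form at [(s, v)]; the minimum is exactly the form of the
   Schur complement at [v], hence positive. *)
- move=> v v0; pose s : R := - a^-1 * (v *m u^T) 0 0.
  have := Ap (row_mx s%:M v).
  have -> : row_mx s%:M v != 0 :> 'rV[R]_(1 + n).
    apply: contraNneq v0 => E; have := congr1 rsubmx E.
    by rewrite row_mxKr linear0 => ->.
  move=> /(_ isT); rewrite EA tr_row_mx mul_row_block mul_row_col.
  have Euv : u *m v^T = ((v *m u^T) 0 0)%:M.
    by rewrite -[LHS]trmxK trmx_mul trmxK -[in RHS](tr_scalar_mx) -mx11_scalar.
  have Evu : v *m u^T = ((v *m u^T) 0 0)%:M by rewrite -mx11_scalar.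
  rewrite mulmxBr mulmxBl -scalemxAr -scalemxAl mulmxA -[v *m u^T *m u *m _]mulmxA.
  rewrite !mulmxDl -[s%:M *m u *m _]mulmxA Euv Evu tr_scalar_mx.
  move: ((v *m u^T) 0 0) @s => q s.
  rewrite -!scalar_mxM !mxE !eqxx /= !mulr1n.
  by congr (0 < _); rewrite /s; field; rewrite gt_eqF.
- exists (block_mx (Num.sqrt a)%:M ((Num.sqrt a)^-1 *: u) 0 V).
  have sa : Num.sqrt a * Num.sqrt a = a by rewrite -expr2 sqr_sqrtr // ltW.
  have s0 : Num.sqrt a != 0 by rewrite gt_eqF // sqrtr_gt0.
  rewrite tr_block_mx mulmx_block trmx0 tr_scalar_mx !(mul0mx, mulmx0, addr0).
  rewrite -scalar_mxM sa mul_scalar_mx scalerA divff // scale1r.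
  rewrite linearZ /= mul_mx_scalar scalerA divff // scale1r.
  rewrite -scalemxAl -scalemxAr scalerA -invfM sa -EV.
  by rewrite addrC subrK -EA.
Qed.

Definition qform (R : realType) (n : nat) (H : 'M[R]_n) (v : 'rV[R]_n) : R :=
  (v *m H *m v^T) 0 0.

(** Reduces the second-order term of the operator to second derivatives along finitely many
    lines. *)
Lemma mxinner_gram (R : realType) (n : nat) (V H : 'M[R]_n) :
  mxinner (V^T *m V) H = \sum_i qform H (row i V).
Proof.
rewrite /mxinner trmx_mul trmxK -mulmxA mxtrace_mulC; apply: eq_bigr => i _.
rewrite /qform -row_mul tr_row [LHS]mxE [RHS]mxE; apply: eq_bigr => j _.
by congr (_ * _); rewrite !mxE.
Qed.

(** * The maximum principle *)

Section Jets.
Variables (R : realType) (n : nat).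
Implicit Types (D : set ('rV[R]_n * R)) (w wt : 'rV[R]_n * R -> R)
  (g : 'rV[R]_n * R -> 'rV[R]_n) (H : 'rV[R]_n * R -> 'M[R]_n).

(* [wt], [g] and [H] give all the directional derivatives of [w] on [D] that
   the parabolic maximum principle sees, without asking for any continuity. *)
Definition is_jet D w wt g H := forall x t, D (x, t) ->
  [/\ is_derive t (1 : R) (slice_t w x) (wt (x, t)),
      (forall v, is_derive x v (slice_x w t) (dotv (g (x, t)) v)) &
      (forall v, is_derive x v (fun y => dotv (g (y, t)) v)
        (qform (H (x, t)) v))].

(** Unfolds to [Ltilde A b w] on the jet [dt w], [grad w], [hess w]. With the derivatives as
    parameters, operators of sums and multiples are computed by algebra alone. *)
Definition jet_op (A : 'rV[R]_n * R -> 'M[R]_n) (b : 'rV[R]_n * R -> 'rV[R]_n)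
    wt g H p : R := wt p - mxinner (A p) (H p) + dotv (b p) (g p).

Lemma dotvC (u v : 'rV[R]_n) : dotv u v = dotv v u.
Proof. by apply: eq_bigr => i _; rewrite mulrC. Qed.

Lemma dotvBl (u u' v : 'rV[R]_n) : dotv (u - u') v = dotv u v - dotv u' v.
Proof. by rewrite -sumrB; apply: eq_bigr => i _; rewrite !mxE mulrBl. Qed.

Lemma dotvDl (u u' v : 'rV[R]_n) : dotv (u + u') v = dotv u v + dotv u' v.
Proof. by rewrite -big_split; apply: eq_bigr => i _; rewrite !mxE mulrDl. Qed.

Lemma dotvZl (c : R) (u v : 'rV[R]_n) : dotv (c *: u) v = c * dotv u v.
Proof. by rewrite mulr_sumr; apply: eq_bigr => i _; rewrite !mxE mulrA. Qed.

Lemma dotvNl (u v : 'rV[R]_n) : dotv (- u) v = - dotv u v.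
Proof. by rewrite -scaleN1r dotvZl mulN1r. Qed.

Lemma qformB (H1 H2 : 'M[R]_n) v : qform (H1 - H2) v = qform H1 v - qform H2 v.
Proof. by rewrite /qform mulmxBr mulmxBl !mxE. Qed.

Lemma qformN (H : 'M[R]_n) v : qform (- H) v = - qform H v.
Proof. by rewrite /qform mulmxN mulNmx !mxE. Qed.

Lemma is_jetB D w1 wt1 g1 H1 w2 wt2 g2 H2 :
  is_jet D w1 wt1 g1 H1 -> is_jet D w2 wt2 g2 H2 ->
  is_jet D (fun p => w1 p - w2 p) (fun p => wt1 p - wt2 p)
    (fun p => g1 p - g2 p) (fun p => H1 p - H2 p).
Proof.
move=> J1 J2 x t Dxt; have [a1 b1 c1] := J1 x t Dxt.
have [a2 b2 c2] := J2 x t Dxt; split.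
- exact: is_deriveB a1 a2.
- by move=> v; rewrite dotvBl; exact: is_deriveB (b1 v) (b2 v).
- move=> v; rewrite qformB; under [fun y => _]funext do rewrite dotvBl.
  exact: is_deriveB (c1 v) (c2 v).
Qed.

Lemma is_jetN D w wt g H : is_jet D w wt g H ->
  is_jet D (fun p => - w p) (fun p => - wt p) (fun p => - g p) (fun p => - H p).
Proof.
move=> J x t Dxt; have [a b c] := J x t Dxt; split.
- exact: is_deriveN a.
- by move=> v; rewrite dotvNl; exact: is_deriveN (b v).
- move=> v; rewrite qformN; under [fun y => _]funext do rewrite dotvNl.
  exact: is_deriveN (c v).
Qed.

Lemma is_jet_subset D D' w wt g H : D' `<=` D ->
  is_jet D w wt g H -> is_jet D' w wt g H.
Proof. by move=> DD J x t /DD /J. Qed.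

Lemma mxinnerBr (A H1 H2 : 'M[R]_n) :
  mxinner A (H1 - H2) = mxinner A H1 - mxinner A H2.
Proof. by rewrite /mxinner mulmxBr linearB. Qed.

Lemma mxinnerNr (A H : 'M[R]_n) : mxinner A (- H) = - mxinner A H.
Proof. by rewrite /mxinner mulmxN linearN. Qed.

Lemma jet_opB A b wt1 g1 H1 wt2 g2 H2 p :
  jet_op A b (fun p => wt1 p - wt2 p) (fun p => g1 p - g2 p)
    (fun p => H1 p - H2 p) p = jet_op A b wt1 g1 H1 p - jet_op A b wt2 g2 H2 p.
Proof. by rewrite /jet_op mxinnerBr dotvC dotvBl !(dotvC _ (b p)); ring. Qed.

Lemma jet_opN A b wt g H p :
  jet_op A b (fun p => - wt p) (fun p => - g p) (fun p => - H p) p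
  = - jet_op A b wt g H p.
Proof. by rewrite /jet_op mxinnerNr dotvC dotvNl !(dotvC _ (b p)); ring. Qed.

End Jets.

Lemma continuous_slice (R : realType) (n : nat) (f : 'rV[R]_n * R -> R)
    (U : set 'rV[R]_n) (x : 'rV[R]_n) (t : R) :
  open U -> {within cyl U, continuous f} -> U x -> 0 < t ->
  {for x, continuous (slice_x f t)}.
Proof.
move=> Uo fc Ux t0.
have oc : open (cyl U).
  rewrite openE => -[y s] [/= Uy s0]; exists (U, [set r | 0 < r]) => //=.
  split; first exact: open_nbhs_nbhs.
  by apply: open_nbhs_nbhs; split => //; exact: open_gt.
have {}fc : {for (x, t), continuous f}.
  by move: fc; rewrite continuous_open_subspace // => /(_ (x, t)); apply; rewrite inE.
rewrite /slice_x; apply: (@continuous_comp _ _ _ (fun y => (y, t)) f) => //.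
have xt : (fun y : 'rV[R]_n => (y, t)) @ x --> (x, t).
  move=> B [[P Q] [/= Px Qt] PQ]; apply: filterS Px => y Py.
  by apply: PQ; split => //=; exact: nbhs_singleton.
exact: xt.
Qed.

(** [is_derive_partials] is used twice, on [w] and on each component of its gradient; this is where
    the continuity clauses of [C21] in space matter. *)
Lemma C21_is_jet (R : realType) (n : nat) (U : set 'rV[R]_n)
    (w : 'rV[R]_n * R -> R) :
  open U -> C21 (cyl U) w -> is_jet (cyl U) w (dt w) (grad w) (hess w).
Proof.
move=> Uo [_ [wt_d _] [wx_d wx_c] [wxx_d wxx_c]] x t [/= Ux t0].
have Un : \forall y \near x, U y by apply: open_nbhs_nbhs.
have first y : U y ->
    forall v, is_derive y v (slice_x w t) (dotv (grad w (y, t)) v).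
  move=> Uy v; have -> : dotv (grad w (y, t)) v = \sum_i v 0 i * dx i w (y, t).
    by apply: eq_bigr => i _; rewrite mxE mulrC.
  apply: (@is_derive_partials R n (slice_x w t) (fun i y => dx i w (y, t))).
    have : \forall z \near y, U z by apply: open_nbhs_nbhs.
    by apply: filterS => z Uz i; apply: derivableP; exact: (wx_d i (z, t)).
  by move=> i; exact: (continuous_slice Uo (wx_c i)).
split => //.
- by have := derivableP (wt_d (x, t) (conj Ux t0)); rewrite /dt derive1E.
- exact: first.
- move=> v; have E : (fun y => dotv (grad w (y, t)) v)
      = \sum_(j < n) (v 0 j *: slice_x (dx j w) t : 'rV[R]_n -> R).
    apply/funext => y; rewrite fct_sumE; apply: eq_bigr => j _.
    by rewrite mxE mulrC.
  rewrite E.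
  have -> : qform (hess w (x, t)) v
      = \sum_(j < n) v 0 j *: (\sum_(i < n) v 0 i * dx i (dx j w) (x, t)).
    rewrite /qform mxE; apply: eq_bigr => j _; rewrite !mxE mulrC.
    by congr (_ * _); apply: eq_bigr => i _; rewrite mxE.
  apply: is_derive_sum => j; apply: is_deriveZ.
  apply: (@is_derive_partials R n _ (fun i y => dx i (dx j w) (y, t))).
    by apply: filterS Un => z Uz i; apply: derivableP; exact: (wxx_d i j (z, t)).
  by move=> i; exact: (continuous_slice Uo (wxx_c i j)).
Qed.

(** At such a point the gradient vanishes, the Hessian form is nonpositive in each direction and the
    time derivative is nonnegative. Factoring [A] turns the trace term into a sum of Hessian forms.
    The coefficients are constants because only their values at the point enter. *)
Lemma jet_op_interior_max (R : realType) (n : nat) (U : set 'rV[R]_n)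
    (s0 : R) (A : 'M[R]_n) (b : 'rV[R]_n) z zt g H (x : 'rV[R]_n) (t : R) :
  open U -> A^T = A -> (forall v : 'rV[R]_n, v != 0 -> 0 < qform A v) ->
  U x -> s0 < t -> is_jet (U `*` [set s | s0 < s <= t]) z zt g H ->
  (forall y s, U y -> s0 < s -> s <= t -> z (y, s) <= z (x, t)) ->
  0 <= jet_op (cst A) (cst b) zt g H (x, t).
Proof.
move=> Uo As Ap Ux st J zmax.
have Jt y : U y -> (U `*` [set s | s0 < s <= t]) (y, t).
  by move=> Uy; split => //=; rewrite st lexx.
have [zt_d _ _] := J x t (Jt x Ux).
have zt0 : 0 <= zt (x, t).
  apply: (derive_left_max (e := t - s0)) zt_d _; first by rewrite subr_gt0.
  by move=> h h0 hs; apply: zmax => //; lra.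
have [r r0 Ur] : exists2 r : R, 0 < r & forall y, `|y - x| < r -> U y.
  have [r r0 H'] := (nbhs_normP _ _).1 (open_nbhs_nbhs (conj Uo Ux)).
  by exists r => // y yx; apply: H'; rewrite /ball_ /= distrC.
have dir v : dotv (g (x, t)) v = 0 /\ qform (H (x, t)) v <= 0.
  (* The [+ 1] covers the direction [v = 0]. *)
  pose e := r / (`|v| + 1).
  have v1 : 0 < `|v| + 1 by rewrite ltr_wpDl.
  have inU h : `|h| < e -> U (h *: v + x).
    rewrite ltr_pdivlMr // => he; apply: Ur; rewrite addrK normrZ.
    by apply: le_lt_trans he; rewrite ler_wpM2l // lerDl.
  have [] := @second_derivative_test R (fun h => z (h *: v + x, t))
    (fun h => dotv (g (h *: v + x, t)) v) (qform (H (x, t)) v) e.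
  + by rewrite divr_gt0.
  + move=> h he; have [_ /(_ v) zx _] := J _ _ (Jt _ (inU h he)).
    by apply/(is_derive_line (slice_x z t)).
  + have [_ _ /(_ v) zxx] := J _ _ (Jt _ Ux).
    apply/(is_derive_line (fun y => dotv (g (y, t)) v)).
    by rewrite scale0r add0r.
  + by move=> h he; rewrite scale0r add0r; apply: zmax => //; exact: inU.
  + by rewrite scale0r add0r.
have [V EV] := cholesky As Ap.
rewrite /jet_op /= dotvC (dir b).1 addr0 EV mxinner_gram subr_ge0.
by apply: le_trans zt0; apply: sumr_le0 => i _; exact: (dir _).2.
Qed.

Lemma bounded_closure (R : realType) (n : nat) (U : set 'rV[R]_n) :
  bounded_set U -> bounded_set (closure U).
Proof.
move=> [M [Mr HM]]; exists M; split => // r Mr' /= x Ux.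
have cl : closed [set y : 'rV[R]_n | `|y| <= r].
  by apply: closed_comp (@closed_le _ r) => y _; exact: norm_continuous.
by have : closure [set y : 'rV[R]_n | `|y| <= r] x;
  [apply: closure_subset Ux; exact: HM | rewrite -(closure_id _).1].
Qed.

(** The maximum over the compact cylinder cannot be at a point where the equation holds, for there
    the operator would be nonnegative. The final time [s1] belongs to that region, so only the
    initial slice and the lateral boundary remain. *)
Lemma strict_max_principle (R : realType) (n : nat) (U : set 'rV[R]_n)
    (s0 s1 : R) A b z zt g H :
  open U -> bounded_set U ->
  (forall p, (U `*` [set s | s0 < s <= s1]) p -> (A p)^T = A p) ->
  (forall p, (U `*` [set s | s0 < s <= s1]) p ->
    forall v : 'rV[R]_n, v != 0 -> 0 < qform (A p) v) ->
  {within closure U `*` `[s0, s1]%classic, continuous z} ->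
  is_jet (U `*` [set s | s0 < s <= s1]) z zt g H ->
  (forall p, (U `*` [set s | s0 < s <= s1]) p -> jet_op A b zt g H p < 0) ->
  (forall x, closure U x -> z (x, s0) <= 0) ->
  (forall x s, bdry U x -> s0 <= s <= s1 -> z (x, s) <= 0) ->
  forall x s, closure U x -> s0 <= s <= s1 -> z (x, s) <= 0.
Proof.
move=> Uo Ub As Ap zc J Lneg z0 zbd x s Ux s01.
have Qc : compact (closure U `*` `[s0, s1]%classic).
  apply: compact_setX; last exact: segment_compact.
  apply: bounded_closed_compact; last exact: closed_closure.
  exact: bounded_closure.
have inQ y r : closure U y -> s0 <= r <= s1 ->
    (y, r) \in closure U `*` `[s0, s1]%classic.
  by move=> Uy r01; rewrite inE; split => //=; rewrite in_itv.
have [|[y r]] := compact_EVT_max _ Qc zc.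
  by exists (x, s); exact/set_mem/inQ.
rewrite inE => -[/= Uy]; rewrite in_itv /= => r01 zmax.
apply: (le_trans (zmax (x, s) (inQ _ _ Ux s01))).
have [sr|rs] := ltP s0 r; last first.
  by have -> : r = s0 by [apply/eqP; rewrite eq_le rs; case/andP: r01 => ->]; exact: z0.
have [Uy'|Uy'] := pselect (U° y); last exact: zbd.
have {}Uy' := interior_subset Uy'.
have Qyr : (U `*` [set s | s0 < s <= s1]) (y, r).
  by split => //=; rewrite sr; case/andP: r01.
have := Lneg _ Qyr; rewrite ltNge => /negP[].
apply: (@jet_op_interior_max R n U s0 (A (y, r)) (b (y, r)) z zt g H y r) => //.
- exact: As.
- exact: Ap.
- apply: is_jet_subset J => -[q a] [Uq /= /andP[a0 a1]]; split => //=.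
  by rewrite a0 (le_trans a1); case/andP: r01.
- move=> q a Uq a0 a1; apply: zmax; apply: inQ; first exact: subset_closure.
  by rewrite (ltW a0) (le_trans a1); case/andP: r01.
Qed.

(** * The barrier *)

Lemma scale_regular (R : realType) (a b : R) : a *: b = a * b.
Proof. by []. Qed.

Section Barrier.
Variables (R : realType) (n : nat).
Implicit Types (x y v : 'rV[R]_n).

Lemma dotvv_ge0 v : 0 <= dotv v v.
Proof. by apply: sumr_ge0 => i _; rewrite -expr2 sqr_ge0. Qed.

Lemma enorm_ge0 v : 0 <= enorm v.
Proof. exact: sqrtr_ge0. Qed.

Lemma sqr_enorm v : enorm v ^+ 2 = dotv v v.
Proof. by rewrite sqr_sqrtr // dotvv_ge0. Qed.

Lemma dotvv_eq0 v : dotv v v = 0 -> v = 0.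
Proof.
move=> /eqP; rewrite psumr_eq0 => [/allP E|i _]; last by rewrite -expr2 sqr_ge0.
apply/rowP => i; rewrite mxE; apply/eqP.
by have := E i (mem_index_enum _); rewrite /= -expr2 sqrf_eq0.
Qed.

(** Cauchy-Schwarz, from the square of [enorm v *: u - enorm u *: v]; the degenerate cases are
    separated because the common factor is divided out. *)
Lemma dotv_le_enorm u v : dotv u v <= enorm u * enorm v.
Proof.
have [u0|u0] := eqVneq (enorm u) 0.
  have -> : u = 0 by apply: dotvv_eq0; rewrite -sqr_enorm u0 expr0n.
  rewrite /dotv big1 ?mulr_ge0 ?enorm_ge0 // => i _.
  by rewrite mxE mul0r.
have [v0|v0] := eqVneq (enorm v) 0.
  have -> : v = 0 by apply: dotvv_eq0; rewrite -sqr_enorm v0 expr0n.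
  rewrite /dotv big1 ?mulr_ge0 ?enorm_ge0 // => i _.
  by rewrite mxE mulr0.
have uv0 : 0 < enorm u * enorm v by rewrite mulr_gt0 // lt0r enorm_ge0 ?u0 ?v0.
have := dotvv_ge0 (enorm v *: u - enorm u *: v).
rewrite dotvBl !(dotvC _ (_ *: u - _)) !dotvBl !dotvZl !(dotvC _ (_ *: _)) !dotvZl.
rewrite -!sqr_enorm (dotvC v u).
set a := enorm u in uv0 *; set b := enorm v in uv0 *; set c := dotv u v => H.
have : 0 <= (a * b) * (a * b - c) by nra.
by rewrite pmulr_rge0 // subr_ge0.
Qed.

Lemma qformD (H1 H2 : 'M[R]_n) v : qform (H1 + H2) v = qform H1 v + qform H2 v.
Proof. by rewrite /qform mulmxDr mulmxDl !mxE. Qed.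

Lemma qformZ (c : R) (H : 'M[R]_n) v : qform (c *: H) v = c * qform H v.
Proof. by rewrite /qform -scalemxAr -scalemxAl !mxE. Qed.

Lemma qform1 v : qform 1%:M v = dotv v v.
Proof. by rewrite /qform mulmx1 mxE; apply: eq_bigr => i _; rewrite mxE. Qed.

Lemma qform_outer y v : qform (y^T *m y) v = dotv y v ^+ 2.
Proof.
rewrite /qform mulmxA -mulmxA mxE big_ord1 expr2; congr (_ * _).
  by rewrite dotvC mxE; apply: eq_bigr => i _; rewrite [_^T _ _]mxE.
by rewrite mxE; apply: eq_bigr => i _; rewrite [_^T _ _]mxE.
Qed.

Lemma mxinnerDr (A H1 H2 : 'M[R]_n) :
  mxinner A (H1 + H2) = mxinner A H1 + mxinner A H2.
Proof. by rewrite /mxinner mulmxDr linearD. Qed.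

Lemma mxinnerZr (A H : 'M[R]_n) (c : R) : mxinner A (c *: H) = c * mxinner A H.
Proof. by rewrite /mxinner -scalemxAr linearZ. Qed.

Lemma mxinner1 (A : 'M[R]_n) : mxinner A 1%:M = \tr A.
Proof. by rewrite /mxinner mulmx1 mxtrace_tr. Qed.

Lemma mxinner_outer (A : 'M[R]_n) y : A^T = A -> mxinner A (y^T *m y) = qform A y.
Proof.
by move=> As; rewrite /mxinner As mulmxA mxtrace_mulC mulmxA /mxtrace big_ord1.
Qed.

Variables (c0 beta kappa s : R) (x0 : 'rV[R]_n).
Hypothesis c0_gt0 : 0 < c0.

Definition barrier (p : 'rV[R]_n * R) : R :=
  expR (kappa - beta * ln (p.2 - s)
        - dotv (p.1 - x0) (p.1 - x0) / (4 * c0 * (p.2 - s))).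

Definition barrier_t (p : 'rV[R]_n * R) : R :=
  barrier p * (dotv (p.1 - x0) (p.1 - x0) / (4 * c0 * (p.2 - s) ^+ 2)
               - beta / (p.2 - s)).

Definition barrier_grad (p : 'rV[R]_n * R) : 'rV[R]_n :=
  (- barrier p / (2 * c0 * (p.2 - s))) *: (p.1 - x0).

Definition barrier_hess (p : 'rV[R]_n * R) : 'M[R]_n :=
  (- barrier p / (2 * c0 * (p.2 - s))) *: 1%:M
  + (barrier p / (2 * c0 * (p.2 - s)) ^+ 2) *: ((p.1 - x0)^T *m (p.1 - x0)).

(** Along a line the exponent of the barrier is quadratic in the parameter and the linear factor of
    its gradient is affine, so this single derivative serves both the gradient and the Hessian. *)
Lemma is_derive_affine_quad (p0 p1 p2 : R) :
  is_derive (0 : R) (1 : R) (fun h : R => p0 + p1 * h + p2 * h ^+ 2) p1.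
Proof.
have i : is_derive (0 : R) (1 : R) (@id R) 1 by exact: is_derive_id.
have -> : (fun h : R => p0 + p1 * h + p2 * h ^+ 2)
    = cst p0 + p1 *: @id R + p2 *: (@id R * @id R) :> (R -> R).
  by apply/funext => h; rewrite expr2.
apply: is_derive_eq (is_deriveD (is_deriveD (is_derive_cst p0 _ _)
  (is_deriveZ p1 i)) (is_deriveZ p2 (is_deriveM i i))) _.
by rewrite /= !scale0r addr0 scaler0 add0r addr0 [_ *: _]mulr1.
Qed.

Lemma is_derive_expR_comp (f : R -> R) (x d : R) :
  is_derive x (1 : R) f d -> is_derive x (1 : R) (expR \o f) (expR (f x) * d).
Proof. by move=> fd; apply: is_derive1_comp. Qed.

Lemma dotv_line (x v u : 'rV[R]_n) (h : R) :
  dotv (h *: v + x - x0) u = dotv (x - x0) u + dotv v u * h.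
Proof. by rewrite -addrA [LHS]dotvDl dotvZl; ring.
Qed.

Lemma dotv_line_sqr (x v : 'rV[R]_n) (h : R) :
  dotv (h *: v + x - x0) (h *: v + x - x0) =
  dotv (x - x0) (x - x0) + 2 * dotv (x - x0) v * h + dotv v v * h ^+ 2.
Proof. by rewrite dotv_line dotvC (dotvC v) !dotv_line (dotvC v (x - x0)); ring. Qed.

Lemma is_derive_barrier_line x v (t : R) :
  is_derive (0 : R) (1 : R) (fun h => barrier (h *: v + x, t))
    (barrier (x, t) * - (2 * dotv (x - x0) v / (4 * c0 * (t - s)))).
Proof.
set k := (4 * c0 * (t - s))^-1; set a := kappa - beta * ln (t - s).
set d := dotv (x - x0) (x - x0); set e := dotv (x - x0) v; set f := dotv v v.
have E : (fun h => barrier (h *: v + x, t))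
    = expR \o (fun h => (a - d * k) + (- (2 * e * k)) * h + (- (f * k)) * h ^+ 2).
  apply/funext => h; rewrite /barrier /= dotv_line_sqr -/a -/k -/d -/e -/f.
  by congr expR; ring.
have Eb : barrier (x, t)
    = expR ((a - d * k) + (- (2 * e * k)) * 0 + (- (f * k)) * 0 ^+ 2).
  by rewrite /barrier /=; congr expR; rewrite -/a -/k -/d; ring.
rewrite E Eb; exact: is_derive_expR_comp (is_derive_affine_quad _ _ _).
Qed.

Lemma barrier_is_jet :
  is_jet [set p | s < p.2] barrier barrier_t barrier_grad barrier_hess.
Proof.
move=> x t /= st; have ts : 0 < t - s by rewrite subr_gt0.
have ts0 : t - s != 0 by rewrite gt_eqF.
have c00 : c0 != 0 by rewrite gt_eqF.
split.
- have -> : slice_t barrier x = expR \o (cst kappa - beta *: (@ln R \o (id - cst s))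
      - (dotv (x - x0) (x - x0) / (4 * c0)) *: (fun r => ((id - cst s) r)^-1))
      :> (R -> R).
    apply/funext => r; rewrite /slice_t /barrier /=; congr expR; congr (_ - _).
    by rewrite invfM mulrA.
  have ids : is_derive t (1 : R) (id - cst s : R -> R) 1.
    apply: is_derive_eq (is_deriveB (is_derive_id t 1) (is_derive_cst s t 1)) _.
    by rewrite subr0.
  have lnd : is_derive t (1 : R) (@ln R \o (id - cst s : R -> R)) ((t - s)^-1 * 1).
    by apply: is_derive1_comp; exact: is_derive1_ln.
  have invd : is_derive t (1 : R) (fun r => ((id - cst s : R -> R) r)^-1)
      (- (t - s) ^- 2 *: 1).
    by apply: is_deriveV.
  apply: is_derive_eq (is_derive_expR_comp (is_deriveB (is_deriveB
    (is_derive_cst kappa t 1) (is_deriveZ beta lnd)) (is_deriveZ _ invd))) _.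
  rewrite /barrier_t /barrier /=; congr (expR _ * _).
    by congr (_ - _); rewrite /= [_ *: _]/(_ * _) /=; rewrite [in RHS]invfM mulrA.
  by rewrite !scale_regular; field; apply/andP.
- move=> v; rewrite -[x in is_derive x]add0r -(scale0r v).
  apply/is_derive_line.
  apply: is_derive_eq (is_derive_barrier_line x v t) _.
  by rewrite /barrier_grad dotvZl /=; field; apply/andP.
- move=> v; rewrite -[x in is_derive x]add0r -(scale0r v).
  apply/is_derive_line.
  set k := - (2 * c0 * (t - s))^-1.
  have -> : (fun h => dotv (barrier_grad (h *: v + x, t)) v) =
      (fun h => barrier (h *: v + x, t))
      * (fun h => (k * dotv (x - x0) v) + (k * dotv v v) * h + 0 * h ^+ 2).
    apply/funext => h; rewrite /barrier_grad dotvZl dotv_line /= /k.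
    by rewrite fctE; ring.
  apply: is_derive_eq (is_deriveM (is_derive_barrier_line x v t)
    (is_derive_affine_quad _ _ _)) _.
  rewrite scale0r add0r /barrier_hess qformD !qformZ qform1 qform_outer /=.
  rewrite !scale_regular /k.
  by field; apply/andP.
Qed.

(** After substitution of [beta] the operator is the barrier times three nonpositive defects: trace
    against [M1], drift against [M2 * RR], ellipticity against [c0]. The [4 * c0] in the exponent is
    what lets the ellipticity term absorb the growth in time. *)
Lemma jet_op_barrier_le0 (A : 'rV[R]_n * R -> 'M[R]_n)
    (b : 'rV[R]_n * R -> 'rV[R]_n) (M1 M2 RR : R) (p : 'rV[R]_n * R) :
  (A p)^T = A p -> c0 * enorm (p.1 - x0) ^+ 2 <= qform (A p) (p.1 - x0) ->
  \tr (A p) <= M1 -> enorm (b p) <= M2 -> 0 <= M2 ->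
  enorm (p.1 - x0) <= RR -> beta = (2 * c0)^-1 * (M1 + M2 * RR) -> s < p.2 ->
  jet_op A b barrier_t barrier_grad barrier_hess p <= 0.
Proof.
move=> As Ae At bM M20 pR betaE sp; have ts : 0 < p.2 - s by rewrite subr_gt0.
have by_ge : - (M2 * RR) <= dotv (b p) (p.1 - x0).
  rewrite lerNl -dotvNl; apply: le_trans (dotv_le_enorm _ _) _.
  have -> : enorm (- b p) = enorm (b p).
    by rewrite /enorm dotvNl dotvC dotvNl opprK.
  by apply: ler_pM => //; exact: enorm_ge0.
rewrite sqr_enorm in Ae.
rewrite /jet_op mxinnerDr !mxinnerZr mxinner1 mxinner_outer //.
rewrite dotvC dotvZl dotvC /barrier_t.
set d := dotv (p.1 - x0) _ in Ae *; set q := qform _ _ in Ae *.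
set e := dotv (b p) _ in by_ge *; set m := \tr _ in At *.
set h := barrier p; set t := p.2 - s in ts *.
have -> : h * (d / (4 * c0 * t ^+ 2) - beta / t)
    - (- h / (2 * c0 * t) * m + h / (2 * c0 * t) ^+ 2 * q) + - h / (2 * c0 * t) * e
  = h * ((m - M1 - (e + M2 * RR)) / (2 * c0 * t) - (q - c0 * d) / (2 * c0 * t) ^+ 2).
  by rewrite betaE; field; rewrite !gt_eqF.
have k0 : 0 < 2 * c0 * t by rewrite !mulr_gt0.
apply: mulr_ge0_le0; first exact: expR_ge0.
rewrite subr_le0; apply: (@le_trans _ _ 0).
  by rewrite pmulr_lle0 ?invr_gt0 //; lra.
by apply: divr_ge0; [lra | exact: sqr_ge0].
Qed.

End Barrier.

Section BarrierBounds.
Variables (R : realType) (n : nat) (c0 beta r0 s : R) (x0 : 'rV[R]_n).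
Hypotheses (c0_gt0 : 0 < c0) (beta_gt0 : 0 < beta) (r0_gt0 : 0 < r0).

(* With this value of [kappa] the maximum over time of the barrier at distance
   [r0] from [x0] is [1]. *)
Definition kappa_norm : R := beta + beta * ln (r0 ^+ 2 / (4 * c0 * beta)).

Let bar := barrier c0 beta kappa_norm s x0.
Let a := r0 ^+ 2 / (4 * c0 * beta).

Let a_gt0 : 0 < a.
Proof. by rewrite divr_gt0 ?exprn_gt0 // !mulr_gt0. Qed.

Lemma ln_le_subr1 (u : R) : 0 < u -> ln u <= u - 1.
Proof. by move=> u0; have := @le_ln1Dx R (u - 1); rewrite subrKC; apply; lra. Qed.

Lemma sqr_dist_le (p : 'rV[R]_n * R) (k : R) : 0 <= k -> k <= enorm (p.1 - x0) ->
  k ^+ 2 <= dotv (p.1 - x0) (p.1 - x0).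
Proof. by move=> k0 kp; rewrite -sqr_enorm ler_sqr ?nnegrE // enorm_ge0. Qed.

(** With [u = a / (p.2 - s)] the bound is [beta * (1 + ln u - u)]. That it is nonpositive gives
    [barrier_le1]; that it tends to minus infinity with [u] large gives [barrier_vanish]. *)
Lemma barrier_exponent_le (p : 'rV[R]_n * R) : r0 <= enorm (p.1 - x0) -> s < p.2 ->
  kappa_norm - beta * ln (p.2 - s) - dotv (p.1 - x0) (p.1 - x0) / (4 * c0 * (p.2 - s))
  <= beta + beta * ln (a / (p.2 - s)) - beta * (a / (p.2 - s)).
Proof.
move=> rp sp; have ts : 0 < p.2 - s by rewrite subr_gt0.
have := sqr_dist_le (ltW r0_gt0) rp.
set d := dotv _ _; set t := p.2 - s in ts *; move=> rd.
have -> : ln (a / t) = ln a - ln t by rewrite ln_div.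
have -> : beta * (a / t) = r0 ^+ 2 / (4 * c0 * t).
  by rewrite /a; field; rewrite !gt_eqF.
have : r0 ^+ 2 / (4 * c0 * t) <= d / (4 * c0 * t).
  by rewrite ler_pM2r // invr_gt0 !mulr_gt0.
by rewrite /kappa_norm -/a; lra.
Qed.

Lemma barrier_le1 (p : 'rV[R]_n * R) :
  r0 <= enorm (p.1 - x0) -> s < p.2 -> bar p <= 1.
Proof.
move=> rp sp; have ts : 0 < p.2 - s by rewrite subr_gt0.
rewrite -expR0 ler_expR; apply: le_trans (barrier_exponent_le rp sp) _.
have : beta * ln (a / (p.2 - s)) <= beta * (a / (p.2 - s) - 1).
  by rewrite ler_pM2l //; exact: ln_le_subr1 (divr_gt0 a_gt0 ts).
by rewrite mulrBr; lra.
Qed.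

Lemma barrier_vanish (e : R) : 0 < e -> exists2 d : R, 0 < d &
  forall p : 'rV[R]_n * R, r0 <= enorm (p.1 - x0) -> s < p.2 -> p.2 < s + d ->
  bar p <= e.
Proof.
(* From [ln u = ln (u / 2) + ln 2] and [ln (u / 2) <= u / 2 - 1] the exponent is at most
   [beta * ln 2 - beta * u / 2], so [beta * u / 2 >= c] is enough. The choice of [d] forces
   [beta * u / 2 >= |c| + 1], a positive quantity whatever the sign of [c]. *)
move=> e0; pose c := beta * ln 2 - ln e.
pose d := a * beta / (2 * (`|c| + 1)).
have c1 : 0 < `|c| + 1 by rewrite ltr_wpDl.
exists d; first by apply: divr_gt0; apply: mulr_gt0.
move=> p rp sp pd; have ts : 0 < p.2 - s by rewrite subr_gt0.
rewrite -[e]lnK ?posrE // ler_expR; apply: le_trans (barrier_exponent_le rp sp) _.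
set u := a / (p.2 - s); have u0 : 0 < u by rewrite divr_gt0.
have uc : `|c| + 1 <= beta * (u / 2).
  have td : (p.2 - s) * (2 * (`|c| + 1)) <= a * beta.
    have : p.2 - s < d by rewrite ltrBlDl.
    by rewrite /d ltr_pdivlMr ?mulr_gt0 // => /ltW.
  have -> : beta * (u / 2) = (a * beta / 2) / (p.2 - s).
    by rewrite /u; field; rewrite gt_eqF.
  by rewrite ler_pdivlMr //; lra.
have lnu : ln u = ln (u / 2) + ln 2.
  have u2 : 0 < u / 2 by rewrite divr_gt0.
  by rewrite -(@lnM R (u / 2) 2) ?posrE ?divfK.
have := ler_norm c; have := ln_le_subr1 (divr_gt0 u0 (ltr0n R 2)).
rewrite lnu /c in uc * => l1 l2.
have : beta * ln (u / 2) <= beta * (u / 2 - 1) by rewrite ler_pM2l.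
by nra.
Qed.

(** At this time the Gaussian term is [beta * d / RR^2], with [d] the squared distance, hence at
    most [beta]; it cancels against the [beta] in [kappa_norm], and what is left of the exponent is
    [beta * ln (r0^2 / RR^2)]. *)
Lemma barrier_lower_bound (RR : R) (p : 'rV[R]_n * R) : 0 < RR ->
  enorm (p.1 - x0) <= RR -> p.2 - s = RR ^+ 2 / (4 * c0 * beta) ->
  (r0 / RR) `^ (2 * beta) <= bar p.
Proof.
move=> RR0 pR ps; have c4 : 0 < 4 * c0 * beta by rewrite !mulr_gt0.
rewrite /powR gt_eqF ?divr_gt0 // /bar /barrier ler_expR ps.
have dR : dotv (p.1 - x0) (p.1 - x0) <= RR ^+ 2.
  by rewrite -sqr_enorm ler_sqr ?nnegrE ?enorm_ge0 // ltW.
set d := dotv _ _ in dR *.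
have -> : d / (4 * c0 * (RR ^+ 2 / (4 * c0 * beta))) = beta * (d / RR ^+ 2).
  by field; rewrite !gt_eqF.
have : d / RR ^+ 2 <= 1 by rewrite ler_pdivrMr ?exprn_gt0 // mul1r.
rewrite /kappa_norm !ln_div ?posrE ?exprn_gt0 // !lnXn // => dR1.
have : beta * (d / RR ^+ 2) <= beta by rewrite ger_pMr.
by rewrite !mulr2n; lra.
Qed.

End BarrierBounds.

Lemma continuous_dotv_sub (R : realType) (n : nat) (x0 : 'rV[R]_n) :
  continuous (fun x : 'rV[R]_n => dotv (x - x0) (x - x0)).
Proof.
move=> x.
have cx i : (fun y : 'rV[R]_n => y 0 i - x0 0 i) @ x --> x 0 i - x0 0 i.
  have c1 : (fun y : 'rV[R]_n => y 0 i) @ x --> x 0 i.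
    exact: (@coord_continuous R 1 n 0 i x).
  exact: cvgB c1 (cvg_cst _).
have E y : dotv (y - x0) (y - x0)
    = \sum_(i < n) (y 0 i - x0 0 i) * (y 0 i - x0 0 i).
  by apply: eq_bigr => i _; rewrite !mxE.
rewrite /continuous_at E; under eq_fun do rewrite E.
apply: (@cvg_big _ _ _ _ _ _ _ (nbhs x) _ _ _ (nbhs_filter x)) => [|i _].
  exact: add_continuous.
exact: cvgM (cx i) (cx i).
Qed.

Lemma continuous_barrier (R : realType) (n : nat) (c0 beta kappa s : R)
    (x0 : 'rV[R]_n) (p : 'rV[R]_n * R) : 0 < c0 -> s < p.2 ->
  {for p, continuous (barrier c0 beta kappa s x0)}.
Proof.
move=> c00 sp; have ts : 0 < p.2 - s by rewrite subr_gt0.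
have ct : (fun q : 'rV[R]_n * R => q.2 - s) @ p --> p.2 - s.
  by apply: cvgB; [exact: cvg_snd | exact: cvg_cst].
have cl : (fun q : 'rV[R]_n * R => ln (q.2 - s)) @ p --> ln (p.2 - s).
  by apply: cvg_comp ct _; exact: continuous_ln.
have cd : (fun q : 'rV[R]_n * R => dotv (q.1 - x0) (q.1 - x0)) @ p
    --> dotv (p.1 - x0) (p.1 - x0).
  apply: (@cvg_comp _ _ _ fst (fun x : 'rV[R]_n => dotv (x - x0) (x - x0))).
    exact: cvg_fst.
  exact: continuous_dotv_sub.
have cV : (fun q : 'rV[R]_n * R => (4 * c0 * (q.2 - s))^-1) @ p
    --> (4 * c0 * (p.2 - s))^-1.
  apply: cvgV; first by rewrite gt_eqF // !mulr_gt0.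
  exact: cvgM (cvg_cst _) ct.
have FF : Filter (nbhs p) by exact: nbhs_filter.
have cE := cvgB (cvgB (cvg_cst kappa) (cvgM (cvg_cst beta) cl)) (cvgM cd cV).
have H := cvg_comp _ _ (cE FF FF FF FF FF FF) (@continuous_expR R _).
exact: H.
Qed.

(** * Comparison over one period *)

Section JetArithmetic.
Variables (R : realType) (n : nat).
Implicit Types (D : set ('rV[R]_n * R)).

Lemma is_jet_time D (f f' : R -> R) :
  (forall x t, D (x, t) -> is_derive t (1 : R) f (f' t)) ->
  is_jet D (fun p => f p.2) (fun p => f' p.2) (fun=> 0) (fun=> 0).
Proof.
have d0 (v : 'rV[R]_n) : dotv (0 : 'rV[R]_n) v = 0.
  by apply: big1 => i _; rewrite mxE mul0r.
move=> fd x t Dxt; split; first exact: fd Dxt.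
- by move=> v; rewrite d0; exact: (is_derive_cst (f t) x v).
- move=> v /=; have -> : qform (0 : 'M[R]_n) v = 0.
    by rewrite /qform mulmx0 mul0mx mxE.
  by rewrite d0; exact: (is_derive_cst (0 : R) x v).
Qed.

Lemma is_jetZ D (k : R) w wt g H : is_jet D w wt g H ->
  is_jet D (fun p => k * w p) (fun p => k * wt p) (fun p => k *: g p)
    (fun p => k *: H p).
Proof.
move=> J x t Dxt; have [a b c] := J x t Dxt; split.
- have -> : slice_t (fun p => k * w p) x = k *: slice_t w x by [].
  exact: is_derive_eq (is_deriveZ k a) _.
- move=> v; have -> : slice_x (fun p => k * w p) t = k *: slice_x w t by [].
  by rewrite dotvZl; exact: is_derive_eq (is_deriveZ k (b v)) _.
- move=> v; rewrite qformZ; under [fun y => _]funext do rewrite dotvZl.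
  have -> : (fun y => k * dotv (g (y, t)) v) = k *: (fun y => dotv (g (y, t)) v) by [].
  exact: is_derive_eq (is_deriveZ k (c v)) _.
Qed.

Lemma jet_opZ A b (k : R) wt g H (p : 'rV[R]_n * R) :
  jet_op A b (fun p => k * wt p) (fun p => k *: g p) (fun p => k *: H p) p
  = k * jet_op A b wt g H p.
Proof. by rewrite /jet_op mxinnerZr dotvC dotvZl (dotvC (g p)); ring. Qed.

Lemma jet_op_time A b (f' : R -> R) (p : 'rV[R]_n * R) :
  jet_op A b (fun p => f' p.2) (fun=> 0) (fun=> 0) p = f' p.2.
Proof.
rewrite /jet_op /mxinner mulmx0 mxtrace0 subr0 dotvC.
by rewrite -(scale0r (0 : 'rV[R]_n)) dotvZl mul0r addr0.
Qed.

End JetArithmetic.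

(** The comparison starts at [s0 > s] because the barrier formula is singular at [s]. There the
    barrier is at most [e'], so the term in [K] dominates [w]; on the lateral boundary the barrier
    is at most 1, so for small [e'] or not that term is nonnegative and [m] dominates. [G] may be
    any nonnegative antiderivative of [F]. *)
Lemma barrier_comparison (R : realType) (n : nat) (U : set 'rV[R]_n)
    A b (c0 M1 M2 r0 RR : R) (x0 : 'rV[R]_n) w wt g H (F G : R -> R)
    (s s0 s1 K m e' : R) :
  let beta := (2 * c0)^-1 * (M1 + M2 * RR) in
  let bar := barrier c0 beta (kappa_norm c0 beta r0) s x0 in
  open U -> bounded_set U ->
  0 < c0 -> 0 < beta -> 0 < r0 -> 0 <= M2 ->
  (forall p, cyl U p -> (A p)^T = A p) ->
  (forall p, cyl U p -> forall v, c0 * enorm v ^+ 2 <= qform (A p) v) ->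
  (forall p, cyl U p -> \tr (A p) <= M1) ->
  (forall p, cyl U p -> enorm (b p) <= M2) ->
  (forall x, closure U x -> r0 <= enorm (x - x0) <= RR) ->
  {within ccyl U, continuous w} -> is_jet (cyl U) w wt g H ->
  (forall p, cyl U p -> jet_op A b wt g H p <= F p.2) ->
  0 <= s -> s < s0 -> s0 <= s1 ->
  (forall t, s0 <= t -> t <= s1 -> is_derive t (1 : R) G (F t)) ->
  (forall t, s0 <= t -> t <= s1 -> 0 <= G t) ->
  0 <= K -> 0 <= m -> 0 < e' ->
  (forall x, closure U x -> w (x, s0) <= K) ->
  (forall x t, bdry U x -> s0 <= t <= s1 -> w (x, t) <= m) ->
  (forall x, closure U x -> bar (x, s0) <= e') ->
  forall x, closure U x -> w (x, s1) <= m + G s1 + K * (1 + e' - bar (x, s1)).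
Proof.
move=> beta bar Uo Ub c00 beta0 r00 M20 As Ae At bM rR wc J wF s_ge0 ss0 s01 Gd
  Gge0 K0 m0 e'0 wK wm bare x Ux.
(* A term of slope [e] in time will make the differential inequality strict; the [+ 1] keeps the
   divisor positive when [s1 = s0]. *)
suff H' e : 0 < e ->
    w (x, s1) <= m + G s1 + K * (1 + e' - bar (x, s1)) + e * (s1 - s0 + 1).
  apply/ler_addgt0Pr => e e0.
  have s1s0 : 0 < s1 - s0 + 1 by lra.
  have := H' (e / (s1 - s0 + 1)) (divr_gt0 e0 s1s0).
  by rewrite divfK ?gt_eqF.
move=> e0; pose f t := m + G t + e * (t - s0) + K * (1 + e').
pose f' t := F t + e.
pose D := U `*` [set t | s0 < t <= s1].
have DU : D `<=` cyl U.
  move=> -[y t] [/= Uy /andP[s0t _]]; split => //=.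
  by rewrite (le_lt_trans s_ge0) // (lt_trans ss0).
have fd t : s0 <= t -> t <= s1 -> is_derive t (1 : R) f (f' t).
  move=> s0t ts1; have Gt := Gd t s0t ts1.
  have dt : is_derive t (1 : R) (id - cst s0 : R -> R) 1.
    apply: is_derive_eq (is_deriveB (is_derive_id t 1) (is_derive_cst s0 t 1)) _.
    by rewrite subr0.
  apply: is_derive_eq (is_deriveD (is_deriveD (is_deriveD (is_derive_cst m t 1) Gt)
    (is_deriveZ e dt)) (is_derive_cst (K * (1 + e')) t 1)) _.
  by rewrite addr0 add0r scale_regular mulr1.
have Jbar : is_jet D bar (barrier_t c0 beta (kappa_norm c0 beta r0) s x0)
    (barrier_grad c0 beta (kappa_norm c0 beta r0) s x0)
    (barrier_hess c0 beta (kappa_norm c0 beta r0) s x0).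
  apply: (is_jet_subset _ (@barrier_is_jet R n c0 beta _ s x0 c00))
    => -[y t] [_ /= /andP[s0t _]].
  exact: lt_trans s0t.
have Jf : is_jet D (fun p => f p.2) (fun p => f' p.2) (fun=> 0) (fun=> 0).
  by apply: is_jet_time => y t [_ /= /andP[s0t ts1]]; apply: fd => //; exact: ltW.
have Jz := is_jetB (is_jet_subset DU J) (is_jetB Jf (is_jetZ K Jbar)).
have ptE y t : s0 <= t -> t <= s1 -> closure U y -> 0 <= bar (y, t) <= 1.
  move=> s0t ts1 Uy; rewrite expR_ge0 barrier_le1 //=; last exact: lt_le_trans s0t.
  by case/andP: (rR y Uy).
suff: (fun p => w p - (f p.2 - K * bar p)) (x, s1) <= 0.
  by rewrite /= /f !mulrBr !mulrDr mulr1; lra.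
apply: (@strict_max_principle R n U s0 s1 A b _ _ _ _ Uo Ub _ _ _ Jz).
- by move=> p /DU; exact: As.
- move=> p /DU pU v v0; apply: lt_le_trans (Ae p pU v).
  rewrite mulr_gt0 // sqr_enorm lt0r dotvv_ge0 andbT.
  by apply: contraNneq v0 => /dotvv_eq0 ->.
- have sub : closure U `*` `[s0, s1]%classic `<=` ccyl U.
    move=> -[y t] [Uy]; rewrite /= in_itv /= => /andP[s0t _]; split => //=.
    by rewrite (le_trans s_ge0) // (le_trans (ltW ss0)).
  apply: within_continuousB; first exact: continuous_subspaceW wc.
  apply: continuous_in_subspaceT => -[y t]; rewrite inE => -[/= _].
  rewrite in_itv /= => /andP[s0t ts1].
  have FF : Filter (nbhs (y, t)) by exact: nbhs_filter.
  have fc : (fun p : 'rV[R]_n * R => f p.2) @ (y, t) --> f t.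
    apply: cvg_comp; first exact: cvg_snd.
    exact: is_derive_continuous (fd t s0t ts1).
  have bc : bar @ (y, t) --> bar (y, t).
    by apply: continuous_barrier => //=; exact: lt_le_trans s0t.
  exact: cvgB fc (cvgM (cvg_cst K) bc).
- move=> p pD; have pU := DU p pD; rewrite !jet_opB jet_opZ jet_op_time /f'.
  have := wF p pU.
  have : jet_op A b (barrier_t c0 beta (kappa_norm c0 beta r0) s x0)
     (barrier_grad c0 beta (kappa_norm c0 beta r0) s x0)
     (barrier_hess c0 beta (kappa_norm c0 beta r0) s x0) p <= 0.
    apply: (@jet_op_barrier_le0 R n c0 beta _ s x0 c00 A b M1 M2 RR p) => //.
    + exact: As.
    + exact: Ae.
    + exact: At.
    + exact: bM.
    + by case: pU => Up _; have /andP[] := rR p.1 (subset_closure Up).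
    + by case: pD => _ /= /andP[s0t _]; exact: lt_trans s0t.
  move=> bar_le0 wF'.
  have : K * jet_op A b (barrier_t c0 beta (kappa_norm c0 beta r0) s x0)
     (barrier_grad c0 beta (kappa_norm c0 beta r0) s x0)
     (barrier_hess c0 beta (kappa_norm c0 beta r0) s x0) p <= 0.
    exact: mulr_ge0_le0.
  lra.
- move=> y Uy /=; have := wK y Uy; have := bare y Uy; have := Gge0 s0 (lexx _) s01.
  rewrite /f subrr mulr0 => G0 be wy.
  have : 0 <= K * (e' - bar (y, s0)) by rewrite mulr_ge0 // subr_ge0.
  by rewrite !mulrDr mulr1; lra.
- move=> y t yb /[dup] /andP[s0t ts1] st; have := wm y t yb st.
  have := Gge0 t s0t ts1; have /andP[_ b1] := ptE y t s0t ts1 yb.1.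
  have : 0 <= K * (1 + e' - bar (y, t)) by rewrite mulr_ge0 //; lra.
  have : 0 <= e * (t - s0) by rewrite mulr_ge0 ?subr_ge0 // ltW.
  by rewrite /f mulrBr; lra.
- exact: Ux.
- by rewrite s01 lexx.
Qed.

Lemma C_nneg_continuous (R : realType) (F : R -> R) (x : R) :
  C_nneg F -> 0 < x -> {for x, continuous F}.
Proof.
move=> [Fc _] x0.
have op : open [set t : R | 0 < t] by exact: open_gt.
have sub : [set t : R | 0 < t] `<=` [set t | 0 <= t] by move=> t /= /ltW.
have := continuous_subspaceW sub Fc.
by rewrite continuous_open_subspace // => /(_ x); apply; rewrite inE.
Qed.

Lemma C_nneg_integrable (R : realType) (F : R -> R) (s u : R) :
  C_nneg F -> 0 <= s ->
  (@lebesgue_measure R).-integrable `[s, u]%classic (EFin \o F).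
Proof.
move=> [Fc _] s0; apply: continuous_compact_integrable.
  exact: segment_compact.
apply: continuous_subspaceW Fc => x; rewrite /= in_itv /= => /andP[sx _].
exact: le_trans sx.
Qed.

(** The strict [s < t] matters: the integral is 0 to the left of [s], so at [s] itself the two-sided
    derivative may fail to exist. *)
Lemma is_derive_window (R : realType) (F : R -> R) (s t : R) :
  C_nneg F -> 0 <= s -> s < t ->
  is_derive t (1 : R)
    (fun r => Rintegral (@lebesgue_measure R) `[s, r]%classic F) (F t).
Proof.
move=> Fn s0 st; have t1 : t < t + 1 by rewrite ltrDl.
have [d e] := continuous_FTC1_closed t1 (C_nneg_integrable (t + 1) Fn s0) st
  (C_nneg_continuous Fn (le_lt_trans s0 st)).
by apply: DeriveDef; [exact: d | rewrite -derive1E].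
Qed.

Lemma window_intE (R : realType) (F : R -> R) (T s : R) :
  C_nneg F -> 0 <= s ->
  window_int F T s =
  (Rintegral (@lebesgue_measure R) `[s, s + T]%classic F)%:E.
Proof.
move=> Fn s0; rewrite /Rintegral fineK //.
by apply: integrable_fin_num => //; exact: C_nneg_integrable.
Qed.

(** For each [t] the barrier is born at [t - T], which lies in the previous period; the elapsed time
    is then exactly [T], where the lower bound on the barrier holds. *)
Lemma one_period_decay (R : realType) (n : nat) (U : set 'rV[R]_n)
    A b (c0 M1 M2 r0 RR : R) (x0 : 'rV[R]_n) w wt g H (F : R -> R)
    (S s0 K m I : R) :
  let beta := (2 * c0)^-1 * (M1 + M2 * RR) in
  let T := RR ^+ 2 / (4 * c0 * beta) in
  open U -> bounded_set U ->
  0 < c0 -> 0 < beta -> 0 < r0 -> 0 < RR -> 0 <= M2 ->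
  (forall p, cyl U p -> (A p)^T = A p) ->
  (forall p, cyl U p -> forall v, c0 * enorm v ^+ 2 <= qform (A p) v) ->
  (forall p, cyl U p -> \tr (A p) <= M1) ->
  (forall p, cyl U p -> enorm (b p) <= M2) ->
  (forall x, closure U x -> r0 <= enorm (x - x0) <= RR) ->
  {within ccyl U, continuous w} -> is_jet (cyl U) w wt g H ->
  (forall p, cyl U p -> jet_op A b wt g H p <= F p.2) -> C_nneg F ->
  0 <= S -> S <= s0 -> 0 <= K -> 0 <= m ->
  (forall x t, bdry U x -> S <= t -> w (x, t) <= m) ->
  (forall t, S <= t -> (window_int F T t <= I%:E)%E) ->
  (forall x t, closure U x -> s0 <= t -> t < s0 + T -> w (x, t) <= K) ->
  forall x t, closure U x -> s0 + T <= t -> t < s0 + T + T ->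
  w (x, t) <= m + I + (1 - (r0 / RR) `^ (2 * beta)) * K.
Proof.
move=> beta T Uo Ub c00 beta0 r00 RR0 M20 As Ae At bM rR wc J wF Fn S0 Ss0 K0 m0
  wm FI wK x t Ux s0t ts0.
have T0 : 0 < T.
  rewrite /T; apply: divr_gt0; rewrite ?exprn_gt0 //.
  by apply: mulr_gt0 => //; exact: mulr_gt0.
have s_s0 : s0 <= t - T by lra.
have s_ge0 : 0 <= t - T by lra.
set s := t - T in s_s0 s_ge0.
pose bar := barrier c0 beta (kappa_norm c0 beta r0) s x0.
set th := (r0 / RR) `^ _.
suff W e : 0 < e -> w (x, t) <= m + I + (1 - th) * K + K * e.
  apply/ler_addgt0Pr => e e0; have K1 : 0 < K + 1 by lra.
  apply: le_trans (W (e / (K + 1)) (divr_gt0 e0 K1)) _.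
  rewrite lerD2l mulrCA ger_pMr // ler_pdivrMr //; lra.
move=> e0; have [d d0 bare] := @barrier_vanish R n c0 beta r0 s x0 c00 beta0 r00 e e0.
(* The comparison starts at [s + k / 2]: [k <= d] makes the barrier at most [e] there,
   [k <= s0 + T - s] keeps that instant in the period where [w <= K], and [k <= T] puts it before
   [t]. *)
pose k := Num.min d (Num.min (s0 + T - s) T).
have k0 : 0 < k by rewrite /k !lt_min d0 T0 andbT /= /s; lra.
have kd : k <= d by rewrite /k ge_min lexx.
have ks : k <= s0 + T - s by rewrite /k ge_min (ge_min _ _ T) lexx orbT.
have kT : k <= T by rewrite /k ge_min (ge_min _ _ T) lexx !orbT.
have tE : t = s + T by rewrite /s subrK.
have s1s : s < s + k / 2 by lra.
have s1t : s + k / 2 <= t by lra.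
(* Integrating from [s] rather than from [s + k / 2] gives a derivative at every time of the
   comparison and, at [t], exactly one full window. *)
pose G r := Rintegral (@lebesgue_measure R) `[s, r]%classic F.
have GI : G t <= I.
  by rewrite -lee_fin tE -window_intE //; apply: FI; lra.
have bt : th <= bar (x, t).
  apply: barrier_lower_bound => //=; first by case/andP: (rR x Ux).
  by rewrite /s subKr.
have := @barrier_comparison R n U A b c0 M1 M2 r0 RR x0 w wt g H F G s (s + k / 2)
  t K m e Uo Ub c00 beta0 r00 M20 As Ae At bM rR wc J wF s_ge0 s1s s1t.
move=> /(_ _ _ K0 m0 e0 _ _ _ x Ux) C.
apply: le_trans (C _ _ _ _ _) _.
- by move=> r sr _; apply: is_derive_window => //; exact: lt_le_trans sr.
- move=> r sr _; apply: Rintegral_ge0 => q; rewrite /= in_itv /= => /andP[sq _].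
  by apply: Fn.2; exact: le_trans sq.
- by move=> y Uy; apply: wK => //; lra.
- by move=> y r yb /andP[sr _]; apply: wm => //; lra.
- move=> y Uy; apply: bare => //=; first by case/andP: (rR y Uy).
  by lra.
- have : K * th <= K * bar (x, t) by rewrite ler_wpM2l.
  rewrite -/bar; lra.
Qed.

(** * Iteration and limits superior *)

(** [c / (1 - eta)] is the fixed point of [K' |-> c + eta * K']; the excess over it is multiplied by
    [eta] at each period. *)
Lemma geometric_iteration (R : realType) (X : Type) (C : set X)
    (u : X -> R -> R) (S T c eta K : R) :
  eta < 1 -> 0 <= eta -> 0 <= c -> 0 <= K -> 0 < T ->
  (forall s K', S <= s -> 0 <= K' ->
    (forall x t, C x -> s <= t -> t < s + T -> u x t <= K') ->
    forall x t, C x -> s + T <= t -> t < s + T + T -> u x t <= c + eta * K') ->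
  (forall x t, C x -> S <= t -> t < S + T -> u x t <= K) ->
  forall k x t, C x -> S + T *+ k <= t -> t < S + T *+ k + T ->
  u x t <= c / (1 - eta) + eta ^+ k * K.
Proof.
move=> eta1 eta0 c0 K0 T0 step uK; have e1 : 0 < 1 - eta by lra.
have ce : 0 <= c / (1 - eta) by rewrite divr_ge0 // ltW.
elim=> [|k IH] x t Cx.
  rewrite mulr0n addr0 expr0 mul1r => St tS.
  by apply: le_trans (uK _ _ Cx St tS) _; rewrite lerDr.
rewrite mulrS (addrC T) addrA => St tS.
have -> : c / (1 - eta) + eta ^+ k.+1 * K
    = c + eta * (c / (1 - eta) + eta ^+ k * K).
  by rewrite exprS; field; rewrite gt_eqF.
apply: (step (S + T *+ k) _ _ _ _ x t Cx St tS).
- by rewrite lerDl mulrn_wge0 // ltW.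
- by rewrite addr_ge0 // mulr_ge0 // exprn_ge0.
- by move=> y r; exact: IH.
Qed.

Lemma eventually_le_fixpoint (R : realType) (X : Type) (C : set X)
    (u : X -> R -> R) (S T c eta K e : R) :
  eta < 1 -> 0 <= eta -> 0 <= c -> 0 <= K -> 0 < T ->
  (forall s K', S <= s -> 0 <= K' ->
    (forall x t, C x -> s <= t -> t < s + T -> u x t <= K') ->
    forall x t, C x -> s + T <= t -> t < s + T + T -> u x t <= c + eta * K') ->
  (forall x t, C x -> S <= t -> t < S + T -> u x t <= K) ->
  0 < e ->
  exists S', forall x t, C x -> S' <= t -> u x t <= c / (1 - eta) + e.
Proof.
move=> eta1 eta0 c0 K0 T0 step uK e0.
have it := geometric_iteration eta1 eta0 c0 K0 T0 step uK.
have [N HN] : exists N, forall k, (N <= k)%N -> eta ^+ k * K <= e.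
  have /cvgrPdist_le /(_ (e / (K + 1))) : GRing.exp eta @ \oo --> (0 : R).
    by apply: cvg_expr; rewrite ger0_norm.
  have K1 : 0 < K + 1 by lra.
  move=> /(_ (divr_gt0 e0 K1)) [N _ HN]; exists N => k Nk.
  have := HN k Nk; rewrite /= sub0r normrN ger0_norm ?exprn_ge0 // => ek.
  apply: (@le_trans _ _ (e / (K + 1) * K)); first by rewrite ler_wpM2r.
  rewrite mulrAC ler_pdivrMr // ler_pM2l //; lra.
exists (S + T *+ N) => x t Cx St.
(* The number of full periods elapsed since [S], which locates [t] in the period starting at
   [S + T *+ k]. *)
pose k := Num.truncn ((t - S) / T).
have q0 : 0 <= (t - S) / T.
  apply: divr_ge0; last exact: ltW.
  have : 0 <= T *+ N by rewrite mulrn_wge0 // ltW.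
  by lra.
have /andP[k1 k2] := truncn_itv q0.
rewrite -/k ler_pdivlMr // mulr_natl in k1.
rewrite -/k ltr_pdivrMr // mulr_natl mulrS in k2.
have Nk : (N <= k)%N.
  rewrite leqNgt; apply/negP => kN.
  have : T *+ k.+1 <= T *+ N by rewrite ler_wpMn2l // ltW.
  rewrite mulrS; lra.
apply: (le_trans (it k x t Cx _ _)); first lra.
  by lra.
by rewrite lerD2l; exact: HN.
Qed.

Lemma limsup_oo_lt (R : realType) (f : R -> \bar R) (y : \bar R) :
  (limsup_oo f < y)%E ->
  exists2 S : R, 0 <= S & forall t, S <= t -> (f t <= y)%E.
Proof.
move=> /ereal_inf_lt[_ [V [M [Mr MV]] <-] Vy].
(* Neighbourhoods of infinity are given by a strict inequality, hence [M + 1]; the maximum with 0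
   keeps later times in the domain of the data. *)
exists (Num.max 0 (M + 1)); first by rewrite le_max lexx.
move=> t; rewrite ge_max => /andP[_ Mt]; apply: le_trans (ltW Vy).
apply: ereal_sup_ubound; exists t => //; apply: MV.
by rewrite (lt_le_trans _ Mt) // ltrDl.
Qed.

Lemma limsup_oo_le (R : realType) (f : R -> \bar R) (y : \bar R) (S : R) :
  (forall t, S <= t -> (f t <= y)%E) -> (limsup_oo f <= y)%E.
Proof.
move=> fy; apply: ge_ereal_inf; exists (ereal_sup (f @` [set t | S < t])).
  exists [set t | S < t] => //; exists S; split => //.
  exact: num_real.
by apply: ge_ereal_sup => _ [t /ltW St <-]; exact: fy.
Qed.

Lemma limsup_oo_ge0 (R : realType) (f : R -> \bar R) :
  (forall t, 0 <= t -> (0 <= f t)%E) -> (0 <= limsup_oo f)%E.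
Proof.
move=> f0; apply: le_ereal_inf_tmp => _ [V [M [Mr MV]] <-].
have t0 : 0 <= Num.max 0 (M + 1) by rewrite le_max lexx.
apply: le_trans (f0 _ t0) _; apply: ereal_sup_ubound; exists (Num.max 0 (M + 1)) => //.
by apply: MV; rewrite lt_max ltrDl ltr01 orbT.
Qed.

(** Shared passage to the limit for both parts. An infinite limit superior makes the right side
    infinite, since the coefficient is positive; otherwise real bounds slightly above the two limits
    are fed to the decay hypothesis. *)
Lemma limsup_decay (R : realType) (n : nat) (C B : set 'rV[R]_n)
    (u : 'rV[R]_n -> R -> R) (I : R -> \bar R) (eta : R) :
  0 <= eta -> eta < 1 -> B !=set0 -> (forall x t, 0 <= u x t) ->
  (forall t, 0 <= t -> (0 <= I t)%E) ->
  (forall S m i e, 0 <= S -> 0 <= m -> 0 <= i -> 0 < e ->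
    (forall x t, B x -> S <= t -> u x t <= m) ->
    (forall t, S <= t -> (I t <= i%:E)%E) ->
    exists S', forall x t, C x -> S' <= t -> u x t <= (m + i) / (1 - eta) + e) ->
  (limsup_oo (fun t => maxS C (fun x => u x t)) <=
   ((2 - eta) / (1 - eta))%:E *
   (limsup_oo (fun t => maxS B (fun x => u x t)) + limsup_oo I))%E.
Proof.
move=> eta0 eta1 [z Bz] u0 I0 H; have e1 : 0 < 1 - eta by lra.
set lm := limsup_oo (fun t => maxS B _); set li := limsup_oo I.
(* A point of [B] is required: the supremum of the empty set is minus infinity. *)
have lm0 : (0 <= lm)%E.
  apply: limsup_oo_ge0 => t _; apply: (@le_trans _ _ (u z t)%:E).
    by rewrite lee_fin.
  by apply: ereal_sup_ubound; exists z.
have li0 : (0 <= li)%E by exact: limsup_oo_ge0.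
have c1 : 0 < (2 - eta) / (1 - eta) by rewrite divr_gt0 //; lra.
have inf y : y = +oo%E -> (limsup_oo (fun t => maxS C (fun x => u x t)) <=
    ((2 - eta) / (1 - eta))%:E * y)%E.
  by move=> ->; rewrite gt0_muley ?leey ?lte_fin.
case lmE : lm lm0 => [a| |] // a0; last by apply: inf; case: (li) li0.
case liE : li li0 => [c| |] // cge0; last by apply: inf.
rewrite lee_fin in a0; rewrite lee_fin in cge0.
apply/lee_addgt0Pr => e e0.
(* Raising both bounds by [d] costs [e / 2] after division by [1 - eta], and the extra [d] costs at
   most [e / 4]. *)
pose d := e * (1 - eta) / 4.
have d0 : 0 < d by rewrite /d divr_gt0 // mulr_gt0.
have [S1 S10 HS1] : exists2 S : R, 0 <= S &
    forall t, S <= t -> (maxS B (fun x => u x t) <= (a + d)%:E)%E.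
  by apply: limsup_oo_lt; rewrite -/lm lmE lte_fin ltrDl.
have [S2 S20 HS2] : exists2 S : R, 0 <= S &
    forall t, S <= t -> (I t <= (c + d)%:E)%E.
  by apply: limsup_oo_lt; rewrite -/li liE lte_fin ltrDl.
have [||||x t Bx|t|S' HS'] := H (Num.max S1 S2) (a + d) (c + d) d.
- by rewrite le_max S10.
- by rewrite addr_ge0 // ltW.
- by rewrite addr_ge0 // ltW.
- exact: d0.
- rewrite ge_max => /andP[St _]; rewrite -lee_fin.
  by apply: le_trans (HS1 t St); apply: ereal_sup_ubound; exists x.
- by rewrite ge_max => /andP[_ St]; exact: HS2.
apply: (@limsup_oo_le R _ _ S') => t St; apply: ge_ereal_sup => _ [x Cx <-].
rewrite -EFinD lee_fin; apply: le_trans (HS' x t Cx St) _.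
(* The coefficient is [1 / (1 - eta) + 1]; the iteration uses the first part and the second adds a
   nonnegative amount. *)
have -> : (2 - eta) / (1 - eta) * (a + c)
    = (a + c) / (1 - eta) + (a + c) by field; rewrite gt_eqF.
have -> : (a + d + (c + d)) / (1 - eta) = (a + c) / (1 - eta) + e / 2.
  by rewrite /d; field; rewrite gt_eqF.
have : d <= e / 4 by rewrite /d ler_pdivrMr // divfK // ger_pMr //; lra.
lra.
Qed.

(** * Geometry of the domain *)

(** Compactness yields a nearest point of the closure, which differs from [x0]; this gives
    positivity of the infimum. A farthest point bounds the distances, so the supremum is
    meaningful. *)
Lemma distance_bounds (R : realType) (n : nat) (U : set 'rV[R]_n) (x0 : 'rV[R]_n) :
  U !=set0 -> bounded_set U -> ~ closure U x0 ->
  0 < r_star U x0 /\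
  forall x, closure U x -> r_star U x0 <= enorm (x - x0) <= R_star U x0.
Proof.
move=> [z Uz] Ub Ux0.
have Uc : compact (closure U).
  apply: bounded_closed_compact; last exact: closed_closure.
  exact: bounded_closure.
have U0 : closure U !=set0 by exists z; exact: subset_closure.
have dc : {within closure U, continuous (fun x => dotv (x - x0) (x - x0))}.
  by apply: continuous_subspaceT; exact: continuous_dotv_sub.
have [c cU cmin] := compact_EVT_min U0 Uc dc.
have [d dU dmax] := compact_EVT_max U0 Uc dc.
rewrite inE in cU.
have c0 : 0 < enorm (c - x0).
  rewrite sqrtr_gt0 lt0r dotvv_ge0 andbT.
  apply/negP => /eqP /dotvv_eq0 /eqP; rewrite subr_eq0 => /eqP cx0.
  by apply: Ux0; rewrite -cx0.
split.
- apply: lt_le_trans c0 _; apply: lb_le_inf.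
    by exists (enorm (z - x0)), z => //; exact: subset_closure.
  by move=> _ [x Ux <-]; rewrite ler_wsqrtr // cmin // inE.
- move=> x Ux; apply/andP; split.
    apply: ge_inf; last by exists x.
    by exists 0 => _ [y _ <-]; exact: enorm_ge0.
  apply: ub_le_sup; last by exists x.
  by exists (enorm (d - x0)) => _ [y Uy <-]; rewrite ler_wsqrtr // dmax // inE.
Qed.

(** A point of the closure with largest first coordinate cannot be interior, as a small move along
    that axis would increase it. This is where [1 <= n] enters. *)
Lemma bdry_nonempty (R : realType) (n : nat) (U : set 'rV[R]_n) :
  (1 <= n)%N -> U !=set0 -> open U -> bounded_set U -> bdry U !=set0.
Proof.
case: n U => // n U _ [z Uz] Uo Ub.
have Uc : compact (closure U).
  apply: bounded_closed_compact; last exact: closed_closure.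
  exact: bounded_closure.
have U0 : closure U !=set0 by exists z; exact: subset_closure.
have cc : {within closure U, continuous (fun x : 'rV[R]_n.+1 => x 0 0)}.
  by apply: continuous_subspaceT; exact: coord_continuous.
have [c cU cmax] := compact_EVT_max U0 Uc cc.
rewrite inE in cU; exists c; split => // /interior_subset Ucc.
have [r r0 H] := (nbhs_normP _ _).1 (open_nbhs_nbhs (conj Uo Ucc)).
pose y : 'rV[R]_n.+1 := c + (r / 2) *: delta_mx 0 0.
have Uy : U y.
  apply: H; rewrite /ball_ /= /y opprD addrA subrr sub0r normrN normrZ.
  have r2 : 0 < r / 2 by rewrite divr_gt0.
  rewrite gtr0_norm //; apply: (@le_lt_trans _ _ (r / 2)).
    by rewrite ger_pMr // norm_delta_mx_le1.
  by move: r0 => /= r0; lra.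
have := cmax y; rewrite inE => /(_ (subset_closure Uy)).
rewrite /y !mxE !eqxx /= mulr1; move: r0 => /= r0; lra.
Qed.

(** Provides the constant from which the iteration starts. *)
Lemma bounded_on_period (R : realType) (n : nat) (U : set 'rV[R]_n)
    (w : 'rV[R]_n * R -> R) (S T : R) :
  bounded_set U -> {within ccyl U, continuous w} -> 0 <= S ->
  exists2 K, 0 <= K &
    forall x t, closure U x -> S <= t -> t < S + T -> `|w (x, t)| <= K.
Proof.
move=> Ub wc S0.
have Qc : compact (closure U `*` `[S, S + T]%classic).
  apply: compact_setX; last exact: segment_compact.
  apply: bounded_closed_compact; last exact: closed_closure.
  exact: bounded_closure.
have [[z Qz]|Q0] := pselect (closure U `*` `[S, S + T]%classic !=set0).
- have sub : closure U `*` `[S, S + T]%classic `<=` ccyl U.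
    move=> -[y t] [Uy]; rewrite /= in_itv /= => /andP[St _]; split => //=.
    exact: le_trans St.
  have wn : {within closure U `*` `[S, S + T]%classic, continuous (fun p => `|w p|)}.
    by move=> p; apply: cvg_norm; exact: (continuous_subspaceW sub wc).
  have [c _ cmax] := compact_EVT_max (ex_intro _ z Qz) Qc wn.
  exists `|w c| => // x t Ux St tS; apply: cmax; rewrite inE; split => //=.
  by rewrite in_itv /= St ltW.
- exists 0 => // x t Ux St tS; exfalso; apply: Q0; exists (x, t); split => //=.
  by rewrite in_itv /= St ltW.
Qed.

Unset Implicit Arguments.
Unset Strict Implicit.

Theorem theorem4p7 (R : realType) (n : nat) (hn : (1 <= n)%N)
  (U : set 'rV[R]_n) (U_neq0 : U !=set0) (U_open : open U)
  (U_bounded : bounded_set U)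
  (A : 'rV[R]_n * R -> 'M[R]_n) (b : 'rV[R]_n * R -> 'rV[R]_n)
  (A_sym : forall p, cyl U p -> (A p)^T = A p)
  (c0 M1 M2 : R) (c0_gt0 : 0 < c0) (M1_gt0 : 0 < M1) (M2_ge0 : 0 <= M2)
  (A_ell : forall p, cyl U p -> forall xi : 'rV[R]_n,
    c0 * enorm xi ^+ 2 <= (xi *m A p *m xi^T) 0 0)
  (A_tr : forall p, cyl U p -> \tr (A p) <= M1)
  (b_bd : forall p, cyl U p -> enorm (b p) <= M2)
  (w : 'rV[R]_n * R -> R)
  (w_cont : {within ccyl U, continuous w})
  (w_C21 : C21 (cyl U) w)
  (x0 : 'rV[R]_n) (hx0 : ~ closure U x0) :
  let r0 := r_star U x0 in
  let RR := R_star U x0 in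
  let beta := (2 * c0)^-1 * (M1 + M2 * RR) in
  let T := RR ^+ 2 / (4 * c0 * beta) in
  let eta := 1 - (r0 / RR) `^ (2 * beta) in
  (forall F1 : R -> R, C_nneg F1 ->
    (forall x t, cyl U (x, t) -> Ltilde A b w (x, t) <= F1 t) ->
    (limsup_oo (fun t => maxS (closure U) (fun x => Num.max 0 (w (x, t)))%R) <=
     ((2 - eta) / (1 - eta))%:E *
     (limsup_oo (fun t => maxS (bdry U) (fun x => Num.max 0 (w (x, t)))%R) +
      limsup_oo (window_int F1 T)))%E)
  /\
  (forall F : R -> R, C_nneg F ->
    (forall x t, cyl U (x, t) -> `|Ltilde A b w (x, t)| <= F t) ->
    (limsup_oo (fun t => maxS (closure U) (fun x => `|w (x, t)|%R)) <=
     ((2 - eta) / (1 - eta))%:E *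
     (limsup_oo (fun t => maxS (bdry U) (fun x => `|w (x, t)|%R)) +
      limsup_oo (window_int F T)))%E).
Proof.
move=> r0 RR beta T eta.
have [r0_gt0 rR] := distance_bounds U_neq0 U_bounded hx0.
have [z Uz] := U_neq0.
have /andP[rz zR] := rR z (subset_closure Uz).
have rRR : r0 <= RR by exact: le_trans zR.
have RR_gt0 : 0 < RR by exact: lt_le_trans rRR.
have beta_gt0 : 0 < beta.
  apply: mulr_gt0; first by rewrite invr_gt0 mulr_gt0.
  by rewrite ltr_pwDl // mulr_ge0 // ltW.
have T_gt0 : 0 < T.
  by apply: divr_gt0; rewrite ?exprn_gt0 //; apply: mulr_gt0 => //; exact: mulr_gt0.
have th_gt0 : 0 < (r0 / RR) `^ (2 * beta) by rewrite powR_gt0 // divr_gt0.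
have th_le1 : (r0 / RR) `^ (2 * beta) <= 1.
  rewrite /powR gt_eqF ?divr_gt0 // -expR0 ler_expR.
  apply: mulr_ge0_le0; first by rewrite mulr_ge0 // ltW.
  by rewrite ln_le0 // ler_pdivrMr // mul1r.
have eta_ge0 : 0 <= eta by rewrite /eta subr_ge0.
have eta_lt1 : eta < 1 by rewrite /eta; lra.
have B0 := bdry_nonempty hn U_neq0 U_open U_bounded.
have J := C21_is_jet U_open w_C21.
have window_ge0 F t : C_nneg F -> 0 <= t -> (0 <= window_int F T t)%E.
  move=> Fn t0; apply: integral_ge0 => s /=; rewrite in_itv /= => /andP[ts _].
  by rewrite lee_fin; apply: Fn.2; exact: le_trans ts.
(* Stated for a general jet so that it applies to [w] and to [- w]. *)
have decay v vt g H F S m i : {within ccyl U, continuous v} ->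
    is_jet (cyl U) v vt g H -> C_nneg F ->
    (forall p, cyl U p -> jet_op A b vt g H p <= F p.2) ->
    0 <= S -> 0 <= m -> (forall t, S <= t -> (window_int F T t <= i%:E)%E) ->
    (forall x t, bdry U x -> S <= t -> v (x, t) <= m) ->
    forall s K, S <= s -> 0 <= K ->
    (forall x t, closure U x -> s <= t -> t < s + T -> v (x, t) <= K) ->
    forall x t, closure U x -> s + T <= t -> t < s + T + T ->
    v (x, t) <= m + i + eta * K.
  move=> vc Jv Fn vF S0 m0 Fi vm s K Ss K0 vK x t.
  exact: (one_period_decay U_open U_bounded c0_gt0 beta_gt0 r0_gt0 RR_gt0 M2_ge0
    A_sym A_ell A_tr b_bd rR vc Jv vF Fn S0 Ss K0 m0 vm Fi vK).
split=> F Fn LF.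
- apply: (limsup_decay (u := fun x t => Num.max 0 (w (x, t)))) => //.
  + by move=> x t; rewrite le_max lexx.
  + by move=> t t0; exact: window_ge0.
  + move=> S m i e S0 m0 i0 e0 um Fi.
    have [K K0 wK] := bounded_on_period T U_bounded w_cont S0.
    apply: (eventually_le_fixpoint (S := S) (u := fun x t => Num.max 0 (w (x, t)))
      eta_lt1 eta_ge0 (addr_ge0 m0 i0) K0 T_gt0 _ _ e0).
      (* The positive part is not smooth, so the decay is applied to [w], bounded by its positive
         part; the value 0 is covered by nonnegativity of the new bound. *)
      move=> s K' Ss K'0 uK' x t Ux st ts; rewrite ge_max; apply/andP; split.
        exact: addr_ge0 (addr_ge0 m0 i0) (mulr_ge0 eta_ge0 K'0).
      apply: (decay w _ _ _ F S m i w_cont J Fn _ S0 m0 Fi _ s K' Ss K'0 _ x t Ux st ts).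
      * by move=> [y r] yr; exact: LF.
      * by move=> y r yb Sr; apply: le_trans (um y r yb Sr); rewrite le_max lexx orbT.
      * move=> y r Uy sr rs; apply: le_trans (uK' y r Uy sr rs).
        by rewrite le_max lexx orbT.
    move=> x t Ux St tS; rewrite ge_max K0 /=.
    exact: le_trans (ler_norm _) (wK x t Ux St tS).
- apply: (limsup_decay (u := fun x t => `|w (x, t)|)) => //.
  + by move=> t t0; exact: window_ge0.
  + move=> S m i e S0 m0 i0 e0 um Fi.
    have [K K0 wK] := bounded_on_period T U_bounded w_cont S0.
    apply: (eventually_le_fixpoint (S := S) (u := fun x t => `|w (x, t)|)
      eta_lt1 eta_ge0 (addr_ge0 m0 i0) K0 T_gt0 _ wK e0).
    (* The two-sided bound on the operator makes both [- w] and [w] satisfy the one-sided hypothesis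
       with the same [F]. *)
    move=> s K' Ss K'0 uK' x t Ux st ts; rewrite ler_norml lerNl; apply/andP; split.
      apply: (decay (fun p => - w p) _ _ _ F S m i _ (is_jetN J) Fn _ S0 m0 Fi _
        s K' Ss K'0 _ x t Ux st ts).
      * by move=> p; apply: cvgN; exact: w_cont.
      * move=> [y r] yr; rewrite jet_opN.
        by apply: le_trans (LF y r yr); rewrite -normrN; exact: ler_norm.
      * move=> y r yb Sr; apply: le_trans (um y r yb Sr).
        by rewrite -normrN; exact: ler_norm.
      * move=> y r Uy sr rs; apply: le_trans (uK' y r Uy sr rs).
        by rewrite -normrN; exact: ler_norm.
    apply: (decay w _ _ _ F S m i w_cont J Fn _ S0 m0 Fi _ s K' Ss K'0 _ x t Ux st ts).
    * by move=> [y r] yr; apply: le_trans (LF y r yr); exact: ler_norm.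
    * by move=> y r yb Sr; apply: le_trans (um y r yb Sr); exact: ler_norm.
    * by move=> y r Uy sr rs; apply: le_trans (uK' y r Uy sr rs); exact: ler_norm.
Qed.
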